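(* Let $(X_n)_{n\ge1}$ be a countable (finite or countably infinite) family of non-empty closed subsets of $\mathbb{R}^d$, $X=\prod_n X_n$, $s_0\in\mathbb{R}^d$, and for every $n$ let $\nu_n$ be a Borel probability measure on $X_n$. Assume that $\int_{X_n}|x|\,d\nu_n(x)<+\infty$ for all $n$, where $|\cdot|$ is the Euclidean norm. Then, with the notions of semi-static strategy and arbitrage and the sets $\Theta,\mathcal{M}(\nu),G(\nu),B(\nu),U(\nu)$ defined in the context, the following are equivalent: (i) there is no model-independent arbitrage; (ii) there is no uniform arbitrage; (iii) $\mathcal{M}(\nu)\ne\emptyset$. Moreover, if (i)--(iii) hold, then the superhedging functional $$\phi(f):=\inf\Big\{m+\sum_n\langle g_n,\nu_n\rangle : (m,\oplus g,h)\in\Theta\text{ such that } m+\oplus g+(h\cdot S)_N\ge f\Big\}$$ satisfies $$\phi(f)=\max_{\mu\in\mathcal{M}(\nu)}\langle f,\mu\rangle\quad\text{for all } f\in B(\nu)\cap(U(\nu)+G(\nu)).$$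
   Context: $X$ carries the product topology and its Borel $\sigma$-algebra; $\pi_n:X\to X_n$ is the $n$-th coordinate projection; $\langle f,\mu\rangle:=\int f\,d\mu$; all (in)equalities between functions on $X$ are pointwise (for every $x\in X$). $B_b$ is the set of bounded Borel measurable functions $X\to\mathbb{R}$, $B$ the set of all Borel measurable functions $X\to\mathbb{R}$, $U\subseteq B$ the subset of upper semicontinuous functions $X\to\mathbb{R}$, and $B_n^+$ the set of Borel measurable functions $X_n\to\mathbb{R}_+=[0,\infty)$. For $g=(g_n)\in\prod_n B_n^+$, $\oplus g:=\sum_n g_n\circ\pi_n:X\to\mathbb{R}_+\cup\{+\infty\}$. Define $$G(\nu):=\Big\{\oplus g:(g_n)\in\prod_n B_n^+\text{ such that }\sum_n\langle g_n,\nu_n\rangle<+\infty\Big\},$$ $$B(\nu):=\{f\in B:|f|\le\oplus g\text{ for some }\oplus g\in G(\nu)\},\qquad U(\nu):=\{f\in U:f^+\in B_b\text{ and }f^-\in B(\nu)\},$$ and $U(\nu)+G(\nu)$ is the set of functions $h+\oplus g$ with $h\in U(\nu)$, $\oplus g\in G(\nu)$. The price process is $S_0:=s_0$, $S_n(x):=x_n$ for $x\in X$, $n\ge1$, with filtration $\mathcal{F}_n:=\sigma(S_j:j\le n)$. $\mathcal{H}$ is the set of all finite sequences $h=(h_1,\dots,h_N)$ ($N$ depending on $h$) such that each $h_n:X\to\mathbb{R}^d$ is $\mathcal{F}_{n-1}$-measurable, and $(h\cdot S)_N:=\sum_{n=1}^N h_n\cdot(S_n-S_{n-1})$. A (semi-static)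 strategy is a triple $(m,\oplus g,h)\in\Theta:=\mathbb{R}\times G(\nu)\times\mathcal{H}$. It is a model-independent arbitrage if $m+\sum_n\langle g_n,\nu_n\rangle\le0$ and $m+\oplus g+(h\cdot S)_N>0$; it is a uniform arbitrage if $m+\sum_n\langle g_n,\nu_n\rangle<0$ and $m+\oplus g+(h\cdot S)_N\ge0$. $\mathcal{P}(\nu)$ is the set of Borel probability measures $\mu$ on $X$ with $\mu\circ\pi_n^{-1}=\nu_n$ for all $n$, and $\mathcal{M}(\nu)$ is the set of $\mu\in\mathcal{P}(\nu)$ under which $S$ is a $d$-dimensional martingale (with respect to $(\mathcal{F}_n)_{n\ge 0}$). *)

(* Defs.v *)
From HB Require Import structures.
From mathcomp Require Import all_boot all_order all_algebra.
From mathcomp Require Import all_classical all_reals all_analysis.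

Set Implicit Arguments.
Unset Strict Implicit.
Unset Printing Implicit Defensive.

Import Order.TTheory GRing.Theory Num.Theory.
Import numFieldNormedType.Exports.

Local Open Scope classical_set_scope.
Local Open Scope ring_scope.

(** The non-empty closed subsets of R^d are bundled, because a measurable type
    of the library has to be pointed. *)
Record closed_nonempty (R : realType) (d : nat) := ClosedNonempty {
  cn_set :> set 'rV[R]_d;
  cn_closed : closed cn_set;
  cn_nonempty : cn_set !=set0 }.

Lemma cn_inhabited (R : realType) (d : nat) (A : closed_nonempty R d) :
  exists x : set_type A, True.
Proof. by have [x Ax] := cn_nonempty A; exists (SigSub (mem_set Ax)). Qed.

(** [A] as a space of its own, with the subspace topology inherited from R^d
    and the Borel sigma-algebra. *)
Definition closed_space (R : realType) (d : nat) (A : closed_nonempty R d) :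
  Type := set_type A.

Section closed_space_instances.
Context (R : realType) (d : nat) (A : closed_nonempty R d).

HB.instance Definition _ := Topological.copy (closed_space A) (set_type A).
HB.instance Definition _ :=
  isPointed.Build (closed_space A) (projT1 (cid (cn_inhabited A))).
HB.instance Definition _ := Measurable.copy (closed_space A)
  (g_sigma_algebraType (@open (closed_space A))).

Definition coords (x : closed_space A) : 'rV[R]_d := set_val x.

End closed_space_instances.

(** A horizon is [Some T] (times 0, 1, ..., T) or [None] (all times in nat). *)
Definition in_horizon (T : option nat) (n : nat) : bool :=
  if T is Some k then (n <= k)%N else true.

(** The index set of the family (X_n) with n >= 1: the positive times. *)
Definition time_index (T : option nat) : Type :=
  {n : nat | (0 < n)%N && in_horizon T n}.

HB.instance Definition _ (T : option nat) := Countable.on (time_index T).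

Definition path_space (R : realType) (d : nat) (T : option nat)
    (X : time_index T -> closed_nonempty R d) : Type :=
  prod_topology (fun n => closed_space (X n)).

Section path_space_instances.
Context (R : realType) (d : nat) (T : option nat).
Variable X : time_index T -> closed_nonempty R d.

HB.instance Definition _ := Topological.copy (path_space X)
  (prod_topology (fun n => closed_space (X n))).
HB.instance Definition _ := Pointed.copy (path_space X)
  (forall n, closed_space (X n)).
HB.instance Definition _ := Measurable.copy (path_space X)
  (g_sigma_algebraType (@open (path_space X))).

Definition coord_proj (n : time_index T) (x : path_space X) : closed_space (X n) :=
  x n.

End path_space_instances.

Notation borel_rV R d := (g_sigma_algebraType (@open 'rV[R]_d)).

Definition dotp (R : realType) (d : nat) (u v : 'rV[R]_d) : R :=
  \sum_(j < d) u ord0 j * v ord0 j.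

(** The norm of the library on row vectors is the maximum norm. *)
Definition euclidean_norm (R : realType) (d : nat) (u : 'rV[R]_d) : R :=
  Num.sqrt (dotp u u).

Definition upper_semicontinuous (R : realType) (E : topologicalType)
    (f : E -> R) : Prop :=
  lower_semicontinuous (fun x => (- f x)%:E).

(** [Z] is a version of the conditional expectation of [Y] given the
    sigma-algebra generated by the set system [C]. *)
Definition is_cond_exp (disp : measure_display) (E : measurableType disp)
    (R : realType) (mu : probability E R) (C : set (set E)) (Y Z : E -> R) :
    Prop :=
  [/\ measurable_fun [set: g_sigma_algebraType C] Z,
      mu.-integrable [set: E] (EFin \o Z) &
      forall A, <<s C >> A ->
        (\int[mu]_(x in A) (Z x)%:E = \int[mu]_(x in A) (Y x)%:E)%E].

(** [M] is a d-dimensional martingale, coordinate by coordinate, for the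
    filtration whose sigma-algebra at time n is generated by [C n]. *)
Definition martingale (disp : measure_display) (E : measurableType disp)
    (R : realType) (d : nat) (T : option nat) (mu : probability E R)
    (C : nat -> set (set E)) (M : nat -> E -> 'rV[R]_d) : Prop :=
  (forall n (j : 'I_d), in_horizon T n ->
     measurable_fun [set: g_sigma_algebraType (C n)]
       (fun x => M n x ord0 j) /\
     mu.-integrable [set: E] (fun x => (M n x ord0 j)%:E)) /\
  (forall n (j : 'I_d), in_horizon T n.+1 ->
     is_cond_exp mu (C n) (fun x => M n.+1 x ord0 j) (fun x => M n x ord0 j)).

Section market.
Context (R : realType) (d : nat) (T : option nat).
Variable X : time_index T -> closed_nonempty R d.

(** [price s0 n] is S_n; beyond the horizon it has the dummy value 0. *)
Definition price (s0 : 'rV[R]_d) (n : nat) (x : path_space X) : 'rV[R]_d :=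
  if n is 0%N then s0
  else if (insub n : option (time_index T)) is Some i then coords (x i) else 0.

(** F_n is the sigma-algebra generated by this set system. *)
Definition filtration_gen (s0 : 'rV[R]_d) (n : nat) : set (set (path_space X)) :=
  \bigcup_(j in [set j : nat | (j <= n)%N])
    preimage_set_system setT (price s0 j : path_space X -> borel_rV R d)
      (@measurable _ (borel_rV R d)).

Definition Bpos (n : time_index T) : set (closed_space (X n) -> R) :=
  [set g : closed_space (X n) -> R | measurable_fun setT g /\ forall x, 0 <= g x].

Definition oplus (g : forall n, closed_space (X n) -> R) (x : path_space X) :
    \bar R :=
  (\esum_(n in [set: time_index T]) (g n (coord_proj n x))%:E)%E.

Variable nu : forall n, probability (closed_space (X n)) R.

Definition static_cost (g : forall n, closed_space (X n) -> R) : \bar R :=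
  (\esum_(n in [set: time_index T]) \int[nu n]_x (g n x)%:E)%E.

Definition static_position (g : forall n, closed_space (X n) -> R) : Prop :=
  (forall n, Bpos (g n)) /\ (static_cost g < +oo)%E.

Definition Gnu : set (path_space X -> \bar R) :=
  [set oplus g | g in static_position].

Definition Bnu : set (path_space X -> R) :=
  [set f : path_space X -> R | measurable_fun setT f /\
           exists2 G, Gnu G & forall x, (`|f x|%:E <= G x)%E].

Definition Bb : set (path_space X -> R) :=
  [set f : path_space X -> R | measurable_fun setT f /\ exists M, forall x, `|f x| <= M].

Definition Unu : set (path_space X -> R) :=
  [set f : path_space X -> R | [/\ measurable_fun setT f, upper_semicontinuous f,
               Bb (f^\+) & Bnu (f^\-)]].

Definition UplusG : set (path_space X -> \bar R) :=
  [set F | exists h G, [/\ Unu h, Gnu G & forall x, F x = ((h x)%:E + G x)%E]].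

Variable s0 : 'rV[R]_d.

(** [nth 0 h n] is h_{n+1}, which has to be F_n-measurable. *)
Definition dynamic_strategy (h : seq (path_space X -> 'rV[R]_d)) : Prop :=
  in_horizon T (size h) /\
  forall n, (n < size h)%N ->
    measurable_fun [set: g_sigma_algebraType (filtration_gen s0 n)]
      (nth (fun=> 0) h n : _ -> borel_rV R d).

Definition trading_gain (h : seq (path_space X -> 'rV[R]_d))
    (x : path_space X) : R :=
  \sum_(n < size h)
    dotp (nth (fun=> 0) h n x) (price s0 n.+1 x - price s0 n x).

Record strategy := Strategy {
  cash : R;
  static : forall n, closed_space (X n) -> R;
  dynamic : seq (path_space X -> 'rV[R]_d);
  staticP : static_position static;
  dynamicP : dynamic_strategy dynamic }.

Definition cost (th : strategy) : \bar R :=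
  ((cash th)%:E + static_cost (static th))%E.

Definition payoff (th : strategy) (x : path_space X) : \bar R :=
  ((cash th)%:E + oplus (static th) x + (trading_gain (dynamic th) x)%:E)%E.

Definition model_independent_arbitrage (th : strategy) : Prop :=
  (cost th <= 0)%E /\ forall x, (0 < payoff th x)%E.

Definition uniform_arbitrage (th : strategy) : Prop :=
  (cost th < 0)%E /\ forall x, (0 <= payoff th x)%E.

Definition Pnu : set (probability (path_space X) R) :=
  [set mu | forall n B, measurable B ->
     pushforward mu (@coord_proj R d T X n) B = nu n B].

Definition Mnu : set (probability (path_space X) R) :=
  [set mu | Pnu mu /\ martingale T mu (filtration_gen s0) (price s0)].

Definition superhedging (f : path_space X -> R) : \bar R :=
  ereal_inf [set cost th | th in
    [set th : strategy | forall x, ((f x)%:E <= payoff th x)%E]].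

End market.

(* Main.v *)
Require Import Defs.
From HB Require Import structures.
From mathcomp Require Import all_boot all_order all_algebra.
From mathcomp Require Import measurable_realfun ring lra.
From mathcomp Require Import all_classical all_reals all_analysis.

Set Implicit Arguments.
Unset Strict Implicit.
Unset Printing Implicit Defensive.

Import Order.TTheory GRing.Theory Num.Theory.
Import numFieldNormedType.Exports.

Local Open Scope classical_set_scope.
Local Open Scope ring_scope.

(** A martingale measure prices every strategy at its cost, and conversely the
    absence of uniform arbitrage produces a pricing rule that is linear, and
    this rule is integration against a martingale measure up to an inequality
    that goes in the right direction.

    Weak duality. Let mu be a martingale measure. Static positions cost their
    mu-expectation, so only the trading gains need care, because a dynamic
    position is an arbitrary adapted function and its gains need not be
    integrable. However, the gains of a superhedge are bounded below by an
    integrable function. Truncating to events on which the past gains and the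
    position are bounded shows that the integrability of the negative part
    passes from each time to the time before ([truncated_step]); hence the gains
    have expectation zero ([integral_gain_eq0]), the expected payoff is the cost
    ([integral_payoff]), and there is neither a model-independent arbitrage nor
    a superhedge cheaper than the expected claim. A uniform arbitrage becomes a
    model-independent one when the money received for it is kept as cash
    ([uniform_arbitrage_model_independent]).

    Pricing rules. The pairs (f, c) such that f can be superhedged at the cost c
    form a convex cone, and absence of uniform arbitrage says that the claim 0
    has no negative cost. Zorn's lemma gives a maximal cone with this property,
    in which every claim that is bounded by cash plus a static position has a
    price at which it is both bought and sold. These prices form a linear
    functional L below the superhedging price. If the sale of one claim f at
    some p not above its superhedging price is put into the cone beforehand,
    then also p <= L f ([linear_pricing_rule]).

    From L to a measure. On indicators L is a finitely additive probability on
    all subsets of the path space. Static positions that pay when a coordinate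
    leaves a compact set make it tight, by Tychonoff's theorem, and they force
    its marginals to be the given ones. Finite additivity and tightness give
    countable additivity on the algebra of sets that are approximated by closed
    sets from inside and by open sets from outside; this algebra contains a
    countable base of the topology, and Caratheodory's construction yields a
    Borel probability mu ([borel_probability_of_content]).

    In general L and integration against mu differ. They agree on
    v (x n) * \1_B x for a continuous integrable v >= 0 and a regular set B
    ([rule_coord_indic]), and L vanishes on trading gains, so mu is a martingale
    measure ([rule_martingale]). For upper semicontinuous f only
    L f <= \int[mu] f holds ([rule_usc_le]), and for f of the form oplus g the
    same inequality follows from the cost of g. This is enough: if p is the
    superhedging price of f, then p <= L f <= \int[mu] f <= p. *)

(** * Linear pricing rules from the absence of arbitrage *)

Section pricing_cone.
Context (R : realType) (V : lmodType R).
Implicit Types (H : set (V * R)) (u v : V) (a c p : R).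

Definition pricing_cone H : Prop :=
  [/\ H (0, 0),
      forall u v c p, H (u, c) -> H (v, p) -> H (u + v, c + p),
      forall a u c, 0 <= a -> H (u, c) -> H (a *: u, a * c) &
      forall c, H (0, c) -> 0 <= c].

(** The cone that arises when [v] may in addition be sold at the price [p]. *)
Definition with_sale H v p : set (V * R) :=
  [set x | exists2 t, 0 <= t & H (x.1 + t *: v, x.2 + t * p)].

Lemma sub_with_sale H v p : H `<=` with_sale H v p.
Proof. by move=> [u c] Hu; exists 0; rewrite //= scale0r mul0r !addr0. Qed.

(** Selling [v] for no more than it costs to superhedge [v] is harmless. *)
Lemma pricing_cone_with_sale H v p : pricing_cone H ->
  (forall c, H (v, c) -> p <= c) -> pricing_cone (with_sale H v p).
Proof.
move=> [H0 HD HZ Hna] pH; split.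
- exact: sub_with_sale.
- move=> u w c q [s s0 Hs] [t t0 Ht]; exists (s + t); rewrite ?addr_ge0//=.
  by rewrite scalerDl mulrDl !(addrACA _ _ (s *: v)) !(addrACA _ _ (s * p)); exact: HD.
- move=> a u c a0 [t t0 Ht]; exists (a * t); rewrite ?mulr_ge0//=.
  by rewrite -scalerA -mulrA -scalerDr -mulrDr; exact: HZ.
- move=> c [t]; rewrite /= add0r le_eqVlt => /predU1P[<-|t0] Ht.
    by move: Ht; rewrite scale0r mul0r addr0; exact: Hna.
  have /pH : H (v, t^-1 * (c + t * p)).
    have := HZ t^-1 _ _ (ltW (_ : 0 < t^-1)) Ht.
    by rewrite scalerA mulVf ?gt_eqF// scale1r invr_gt0; exact.
  by rewrite mulrDr mulKf ?gt_eqF// lerDr pmulr_rge0// invr_gt0.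
Qed.

(** Zorn's lemma applies because the four conditions concern at most two
    elements at a time. *)
Lemma maximal_pricing_cone H : pricing_cone H ->
  exists M, [/\ pricing_cone M, H `<=` M &
    forall M', pricing_cone M' -> M `<=` M' -> M' `<=` M].
Proof.
move=> coneH.
(* joining [H] to the members of a chain takes care of the empty chain *)
pose P A := pricing_cone (A `|` H).
have PH : P set0 by rewrite /P set0U.
have [F FP Ftot|M [PM Mmax]] := @Zorn_bigcup _ P.
  set U := \bigcup_(A in F) A.
  have both x y : (U `|` H) x -> (U `|` H) y ->
      exists A, [/\ P A, A `<=` U, (A `|` H) x & (A `|` H) y].
    move=> [[A FA Ax]|Hx] [[B FB By]|Hy].
    - have [AB|BA] := Ftot _ _ FA FB.
        by exists B; split=> [|z Bz||]; [exact: FP|exists B|left; exact: AB|left].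
      by exists A; split=> [|z Az||]; [exact: FP|exists A|left|left; exact: BA].
    - by exists A; split=> [|z Az||]; [exact: FP|exists A|left|right].
    - by exists B; split=> [|z Bz||]; [exact: FP|exists B|right|left].
    - by exists set0; split => //; right.
  split.
  - by right; case: coneH.
  - move=> u v c p Uu Uv; have [A [[_ AD _ _] AU Au Av]] := both _ _ Uu Uv.
    by apply: (setSU AU); exact: AD.
  - move=> a u c a0 Uu; have [A [[_ _ AZ _] AU Au _]] := both _ _ Uu Uu.
    by apply: (setSU AU); exact: AZ.
  - move=> c Uc; have [A [[_ _ _ Ana] AU Ac _]] := both _ _ Uc Uc.
    exact: Ana.
exists (M `|` H); split=> [//||M' coneM' MM']; first exact: subsetUr.
have [->|M'M] := eqVneq M' M; first exact: subsetUl.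
have MsubM' : M `<=` M' by apply: subset_trans MM'; exact: subsetUl.
exfalso; apply: (Mmax M').
  by rewrite properEneq eq_sym; split.
by rewrite /P setUidl//; apply: subset_trans MM'; exact: subsetUr.
Qed.

(** In a maximal cone every claim that can be bought and sold at all has one
    price at which it can be bought as well as sold: otherwise a sale at the
    superhedging price would enlarge the cone. *)
Lemma two_sided_price M v : pricing_cone M ->
  (forall M', pricing_cone M' -> M `<=` M' -> M' `<=` M) ->
  (exists c, M (v, c)) -> (exists c, M (- v, c)) ->
  exists c, M (v, c) /\ M (- v, - c).
Proof.
move=> coneM maxM [b Mb] [b' Mb'].
have [M0 MD _ Mna] := coneM.
have sale w q : M (w, q) -> (exists c, M (- w, c)) ->
    M (- w, - inf [set c | M (w, c)]).
  move=> Mw [q' Mw']; have infM : has_inf [set c | M (w, c)].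
    split; first by exists q.
    exists (- q') => c Mc; rewrite -subr_ge0 opprK.
    by apply: Mna; rewrite -(subrr w); exact: MD.
  have := maxM _ (pricing_cone_with_sale coneM (ge_inf infM.2)) (@sub_with_sale _ _ _).
  apply; exists 1; rewrite //= scale1r mul1r !addNr; exact: M0.
have Mv := sale _ _ Mb (ex_intro _ _ Mb').
have MNv : M (v, - inf [set c | M (- v, c)]).
  by have := sale _ _ Mb'; rewrite opprK; apply; exists b.
set p := inf _ in Mv; set q := inf _ in MNv; exists p; split => //.
have pq : p = - q.
  have sum0 c c' : M (v, c) -> M (- v, c') -> - c <= c'.
    by move=> Mc Mc'; rewrite -subr_ge0 opprK addrC; apply: Mna;
      rewrite -(subrr v); exact: MD.
  apply/eqP; rewrite eq_le; apply/andP; split.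
    apply: (ge_inf _ MNv); exists (- b') => c Mc.
    by rewrite lerNl; exact: sum0.
  apply: lb_le_inf; first by exists b.
  by move=> c Mc; rewrite lerNl; apply: lb_le_inf; [exists b'|move=> ?; exact: sum0].
by rewrite pq.
Qed.

(** A form of the Hahn-Banach theorem: the two-sided prices of a maximal cone are
    unique because 0 has no negative price, and therefore linear. The cone is
    made to contain the sale of [v0] at [p0] before it is enlarged, which gives
    the last conclusion. *)
Lemma linear_pricing_rule H v0 p0 : pricing_cone H ->
  (forall c, H (v0, c) -> p0 <= c) ->
  let E := [set v | (exists c, H (v, c)) /\ exists c, H (- v, c)] in
  exists L : V -> R,
  [/\ forall u v, E u -> E v -> L (u + v) = L u + L v,
      forall a v, E v -> L (a *: v) = a * L v,
      forall v c, E v -> H (v, c) -> L v <= c &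
      E v0 -> p0 <= L v0].
Proof.
move=> coneH Hp0 E.
have [M [coneM sub maxM]] :=
  maximal_pricing_cone (pricing_cone_with_sale coneH Hp0).
have {sub}[HM Mv0] : H `<=` M /\ M (- v0, - p0).
  split; first exact/(subset_trans _ sub)/sub_with_sale.
  apply: sub; exists 1; rewrite //= scale1r mul1r !addNr.
  by case: coneH.
have [M0 MD MZ Mna] := coneM.
pose two_sided v c := M (v, c) /\ M (- v, - c).
have ex_two_sided v : E v -> exists c, two_sided v c.
  by move=> [[c Hc] [c' Hc']]; apply: two_sided_price => //;
    [exists c|exists c']; exact: HM.
have below v c c' : two_sided v c -> M (v, c') -> c <= c'.
  by move=> [_ MN] Mv; rewrite -subr_ge0; apply: Mna; rewrite -(subrr v); exact: MD.
have unique v c c' : two_sided v c -> two_sided v c' -> c = c'.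
  by move=> vc vc'; apply/eqP; rewrite eq_le (below v c _ vc vc'.1) (below v c' _ vc' vc.1).
pose L v := xget 0 [set c | two_sided v c].
have LP v : E v -> two_sided v (L v).
  by move=> /ex_two_sided [c vc]; exact: (xgetI 0 vc).
have LE v c : two_sided v c -> L v = c.
  by move=> vc; apply: (unique v) => //; exact: (xgetI 0 vc).
exists L; split.
- move=> u v /LP[Mu MNu] /LP[Mv MNv]; apply: LE.
  by split; [exact: MD|rewrite !opprD; exact: MD].
- move=> a v /LP[Mv MNv]; apply: LE; have [a0|a0] := leP 0 a.
    by split; [exact: MZ|rewrite -scalerN -mulrN; exact: MZ].
  split; last by rewrite -scaleNr -mulNr; apply: MZ; rewrite // oppr_ge0 ltW.
  by rewrite -[_ *: _]opprK -[_ * _]opprK -scaleNr -scalerN -mulNr -mulrN;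
    apply: MZ; rewrite // oppr_ge0 ltW.
- by move=> v c /LP vL /HM; exact: below.
- move=> /LP [ML _]; rewrite -subr_ge0 addrC; apply: Mna.
  by rewrite -(addNr v0); exact: MD.
Qed.

End pricing_cone.

(** * Tight finitely additive probabilities and the Borel measures they carry *)

Record tight_content (R : realType) (T : topologicalType) := TightContent {
  content_val :> set T -> R;
  content_ge0 : forall A, 0 <= content_val A;
  contentU : forall A B, A `&` B = set0 ->
    content_val (A `|` B) = content_val A + content_val B;
  contentT : content_val setT = 1;
  content_tight : forall e, 0 < e ->
    exists2 K, compact K & content_val (~` K) <= e }.

(** The sets on which a content defined on all subsets is governed by the
    topology. *)
Definition regular_set (R : realType) (T : topologicalType)
    (m : tight_content R T) : set (set T) :=
  [set A | forall e, 0 < e -> exists C U,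
     [/\ closed C, open U, C `<=` A, A `<=` U & m (U `\` C) <= e]].

Section tight_content_theory.
Context (R : realType) (T : topologicalType) (m : tight_content R T).
Implicit Types (A B C U : set T) (e : R).

Lemma contentUD A B : m (A `|` B) = m A + m (B `\` A).
Proof.
rewrite -contentU; last exact: setDIK.
congr (m _); apply/seteqP; split=> x.
  by move=> [Ax|Bx]; [left|have [Ax|nAx] := pselect (A x); [left|right]].
by move=> [Ax|[Bx _]]; [left|right].
Qed.

Lemma le_content A B : A `<=` B -> m A <= m B.
Proof. by move=> /setUidr <-; rewrite contentUD lerDl content_ge0. Qed.

Lemma content_subU A B C : A `<=` B `|` C -> m A <= m B + m C.
Proof.
move=> /le_content /le_trans; apply; rewrite contentUD lerD2l.
by apply: le_content; exact: subDsetl.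
Qed.

Lemma content0 : m set0 = 0.
Proof. by apply: (addrI (m set0)); rewrite -contentU ?setI0// setU0 addr0. Qed.

Lemma contentC A : m (~` A) = 1 - m A.
Proof. by rewrite -(contentT m) -(setUv A) contentU ?setICr// addrC addKr. Qed.

Lemma content_bigsetU (I : Type) (s : seq I) (F : I -> set T) A :
  A `<=` \big[setU/set0]_(i <- s) F i -> m A <= \sum_(i <- s) m (F i).
Proof.
move=> /le_content /le_trans; apply.
apply: (big_ind2 (fun B x => m B <= x)) => //; first by rewrite content0.
by move=> B x C y Bx Cy; apply: (le_trans _ (lerD Bx Cy)); exact: content_subU.
Qed.

Lemma regular_setC A : regular_set m A -> regular_set m (~` A).
Proof.
move=> rA e e0; have [C [U [cC oU CA AU mUC]]] := rA e e0.
exists (~` U), (~` C); split; [exact: open_closedC|exact: closed_openC| | |].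
- exact: subsetC.
- exact: subsetC.
- by rewrite setDE setCK setIC -setDE.
Qed.

Lemma regular_setU A B :
  regular_set m A -> regular_set m B -> regular_set m (A `|` B).
Proof.
move=> rA rB e e0; have e20 : 0 < e / 2 by rewrite divr_gt0.
have [C [U [cC oU CA AU mUC]]] := rA _ e20.
have [D [V [cD oV DB BV mVD]]] := rB _ e20.
exists (C `|` D), (U `|` V); split.
- exact: closedU.
- exact: openU.
- exact: setUSS.
- exact: setUSS.
- rewrite [leRHS]splitr; apply: (le_trans _ (lerD mUC mVD)); apply: content_subU => x.
  by move=> [[Ux|Vx] /not_orP[nC nD]]; [left|right].
Qed.

Lemma regular_set0 : regular_set m set0.
Proof.
by move=> e /ltW e0; exists set0, set0; split => //; [exact: closed0|exact: open0|
  rewrite setD0 content0].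
Qed.

Lemma regular_setI A B :
  regular_set m A -> regular_set m B -> regular_set m (A `&` B).
Proof.
by move=> rA rB; rewrite -[A `&` B]setCK setCI; apply/regular_setC/regular_setU;
  exact: regular_setC.
Qed.

Lemma regular_setT : regular_set m setT.
Proof. by rewrite -setC0; exact/regular_setC/regular_set0. Qed.

End tight_content_theory.

(** Up to an error [e], the set [A] may be replaced by a compact subset and each
    [F n] by an open superset, and then finitely many of them suffice. *)
Lemma regular_set_sigma_subadditive (R : realType) (T : ptopologicalType)
    (m : tight_content R T) (A : set T) (F : (set T)^nat) :
  (forall n, regular_set m (F n)) -> regular_set m A ->
  A `<=` \bigcup_n F n -> ((m A)%:E <= \sum_(n <oo) (m (F n))%:E)%E.
Proof.
move=> rF rA AF.
suff small e : 0 < e ->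
    ((m A)%:E <= \sum_(n <oo) (m (F n))%:E + (e + e + e)%:E)%E.
  apply/lee_addgt0Pr => e e0.
  have := small (e / 3) (divr_gt0 e0 (ltr0n _ 3)).
  by rewrite (_ : e / 3 + e / 3 + e / 3 = e)//; field.
move=> e0.
have [C [U [cC _ CA AU mUC]]] := rA _ e0.
have [K cK mK] := content_tight m e0.
have {}rF n : exists U, [/\ open U, F n `<=` U & m U <= m (F n) + e / (2 ^ n.+1)%:R].
  have en0 : 0 < e / (2 ^ n.+1)%:R by rewrite divr_gt0// ltr0n expn_gt0.
  have [D [V [_ oV DF FV mVD]]] := rF n _ en0.
  exists V; split => //; apply: (le_trans _ (lerD (le_content m DF) mVD)).
  by apply: content_subU => x Vx; have [Dx|nDx] := pselect (D x); [left|right].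
have {rF} [V /all_and3[oV FV mV]] := choice rF.
have : compact (K `&` C) by exact: compact_closedI.
rewrite compact_cover => /(_ nat setT V (fun n _ => oV n))[|D _].
  by move=> x [_ /CA/AF[n _ Fnx]]; exists n => //; exact: FV.
rewrite /cover bigcup_fset => KCV.
have mKC : m (K `&` C) <= \sum_(n <- finmap.enum_fset D) (m (F n) + e / (2 ^ n.+1)%:R).
  by apply: le_trans (content_bigsetU m KCV) _; exact: ler_sum.
apply: (@le_trans _ _ (m (K `&` C) + (e + e))%:E).
  rewrite lee_fin addrC; apply: (le_trans _ (lerD (lerD mUC mK) (lexx _))).
  rewrite -addrA.
  apply: (le_trans (content_subU m _) (lerD (lexx _) (content_subU m (@subset_refl _ _)))).
  move=> x Ax; have [Cx|nCx] := pselect (C x); last by left; split => //; exact: AU.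
  by right; have [Kx|nKx] := pselect (K x); [right|left].
rewrite EFinD -(addrA e) (EFinD e (e + e)) addeA leeD2r//.
apply: (@le_trans _ _ (\sum_(n <oo) ((m (F n))%:E + (e / (2 ^ n.+1)%:R)%:E))%E).
  apply: le_trans (lee_sum_fset_lim D xpredT _) => [|n _].
    by under eq_bigr do rewrite -EFinD; rewrite sumEFin lee_fin.
  by rewrite -EFinD lee_fin addr_ge0 ?content_ge0// divr_ge0// ltW.
by apply: epsilon_trick => [n|]; rewrite ?lee_fin ?content_ge0// ltW.
Qed.

(** A copy of [T] that carries the algebra of regular sets, because [T] may have
    another measurable structure. *)
Definition regular_type (R : realType) (T : ptopologicalType)
  (m : tight_content R T) : Type := T.

Definition regular_display (R : realType) (T : ptopologicalType)
  (m : tight_content R T) : measure_display. Proof. by []. Qed.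

Section regular_extension.
Context (R : realType) (T : ptopologicalType) (m : tight_content R T).

HB.instance Definition _ := Pointed.copy (regular_type m) T.
HB.instance Definition _ := isAlgebraOfSets.Build (regular_display m)
  (regular_type m) (regular_set0 m) (@regular_setU _ _ m) (@regular_setC _ _ m).

Let content_EFin (A : set (regular_type m)) : \bar R := (m A)%:E.

Let content_EFin_ge0 A : (0 <= content_EFin A)%E.
Proof. by rewrite lee_fin content_ge0. Qed.

Let content_EFin_additive : measure_function.semi_additive content_EFin.
Proof.
move=> F n _ tF _; rewrite /content_EFin sumEFin; congr EFin.
elim: n => [|n IH]; first by rewrite !big_ord0 content0.
rewrite !big_ord_recr/= contentU ?IH//.
by apply: (@trivIset_bigsetUI _ predT) => //; rewrite /predT /= trueE.
Qed.

HB.instance Definition _ := isContent.Build _ (regular_type m) R content_EFin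
  content_EFin_ge0 content_EFin_additive.

Let content_EFin_subadditive : measurable_subset_sigma_subadditive content_EFin.
Proof. by move=> A F rF rA; exact: regular_set_sigma_subadditive. Qed.

HB.instance Definition _ := Content_SigmaSubAdditive_isMeasure.Build _ R
  (regular_type m) content_EFin content_EFin_subadditive.

Hypothesis open_regular : forall U : set T, open U -> <<s regular_set m >> U.

Let measurable_open : <<s @open T >> `<=` <<s regular_set m >>.
Proof. by apply: smallest_sub => //; exact: smallest_sigma_algebra. Qed.

Let borel_extension (A : set (g_sigma_algebraType (@open T))) : \bar R :=
  measure_extension content_EFin A.

Let borel_extension0 : borel_extension set0 = 0%E.
Proof. exact: measure0. Qed.

Let borel_extension_ge0 A : (0 <= borel_extension A)%E.
Proof. exact: measure_ge0. Qed.

Let borel_extension_semi_sigma_additive : semi_sigma_additive borel_extension.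
Proof.
move=> F mF tF mUF; apply: (@measure_semi_sigma_additive _
  (g_sigma_algebraType (@measurable _ (regular_type m))) _
  (measure_extension content_EFin)) => //.
- by move=> n; exact: (measurable_open (mF n)).
- exact: (measurable_open mUF).
Qed.

HB.instance Definition _ := isMeasure.Build _ (g_sigma_algebraType (@open T)) R
  borel_extension borel_extension0 borel_extension_ge0
  borel_extension_semi_sigma_additive.

Let borel_extensionE A : regular_set m A -> borel_extension A = (m A)%:E.
Proof. exact: (@measurable_mu_extE _ _ (regular_type m) content_EFin). Qed.

Let borel_extensionT : borel_extension setT = 1%E.
Proof. by rewrite borel_extensionE ?contentT; [|exact: regular_setT]. Qed.

HB.instance Definition _ := Measure_isProbability.Build _ _ R borel_extension
  borel_extensionT.

(** Tightness turns finite additivity into countable additivity on the algebra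
    of regular sets, so that Caratheodory's construction applies. *)
Lemma borel_probability_of_content :
  exists mu : probability (g_sigma_algebraType (@open T)) R,
    forall A, regular_set m A -> mu A = (m A)%:E.
Proof. by exists borel_extension. Qed.

End regular_extension.

(** * Topology of the path space *)

Section rational_boxes.
Context (R : realType) (d : nat).
Implicit Types (q : 'rV[rat]_d) (k : nat) (x : 'rV[R]_d).

Definition open_box q k : set 'rV[R]_d :=
  [set x | forall j, `|x ord0 j - ratr (q ord0 j)| < k.+1%:R^-1].

Definition closed_box q k : set 'rV[R]_d :=
  [set x | forall j, `|x ord0 j - ratr (q ord0 j)| <= k.+1%:R^-1].

Lemma open_box_sub q k : open_box q k `<=` closed_box q k.
Proof. by move=> x qx j; exact: ltW. Qed.

Lemma open_open_box q k : open (open_box q k).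
Proof.
rewrite openE => x qx.
exists (fun _ j => [set t : R | `|t - ratr (q ord0 j)| < k.+1%:R^-1]).
  move=> i j; apply: open_nbhs_nbhs; split; last by rewrite (ord1 i); exact: qx.
  by have := @ball_open R R (ratr (q ord0 j)) k.+1%:R^-1;
    congr open; apply/seteqP; split=> t; rewrite /ball/= distrC.
by move=> y qy j; exact: qy.
Qed.

Lemma closed_entry_dist_le (a : 'I_d -> R) (r : R) :
  closed [set x : 'rV[R]_d | forall j, `|x ord0 j - a j| <= r].
Proof.
rewrite (_ : mkset _ = \bigcap_j
    ((fun x : 'rV[R]_d => `|x ord0 j - a j|) @^-1` [set t | t <= r])).
  apply: closed_bigI => j _; apply: preimage_closed; last exact: closed_le.
  move=> x _; apply: (@continuous_comp _ _ _ (fun x : 'rV[R]_d => x ord0 j : R)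
    (fun t : R => `|t - a j|)); first exact: coord_continuous.
  by apply: cvg_norm; apply: cvgB; [exact: cvg_id|exact: cvg_cst].
by apply/seteqP; split=> x ax j; [move=> _|]; exact: ax.
Qed.

Lemma closed_closed_box q k : closed (closed_box q k).
Proof. exact: closed_entry_dist_le. Qed.

Lemma rational_box_base x (U : set 'rV[R]_d) : nbhs x U ->
  exists q k, open_box q k x /\ closed_box q k `<=` U.
Proof.
move=> /nbhs_ballP[e /= e0 eU].
have [k ke] : exists k, k.+1%:R^-1 < e / 2 :> R.
  have e20 : 0 < e / 2 by rewrite divr_gt0.
  have [k _ kP] := near_infty_natSinv_lt (PosNum e20).
  by exists k; apply: (kP k) => /=.
have rat_near j : exists q : rat, `|x ord0 j - ratr q| < k.+1%:R^-1.
  have /rat_in_itvoo[q] : x ord0 j - k.+1%:R^-1 < x ord0 j + k.+1%:R^-1.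
    by rewrite ltrBlDr -addrA ltrDl addr_gt0.
  by rewrite in_itv/= => qx; exists q; rewrite ltr_distlC.
have [q qP] := choice rat_near.
exists (\row_j q j), k; split=> [j|y yq]; first by rewrite mxE.
apply: eU; split=> // i j; rewrite (ord1 i) /ball/=.
have := yq j; rewrite mxE => {}yq.
rewrite (le_lt_trans (ler_distD (ratr (q j)) _ _))// [ltRHS]splitr ltr_leD//.
  exact: lt_trans ke.
by rewrite distrC (le_trans yq)// ltW.
Qed.

End rational_boxes.

Lemma bigcup_countType (T : Type) (C : countType) (G : set (set T))
    (P : set C) (F : C -> set T) :
  G set0 -> (forall c, P c -> G (F c)) ->
  exists2 A : (set T)^nat, forall n, G (A n) & \bigcup_(c in P) F c = \bigcup_n A n.
Proof.
move=> G0 GF; exists (fun n => if unpickle n is Some c then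
    if c \in P then F c else set0 else set0).
  by move=> n; case: unpickle => [c|//]; case: ifP => // /set_mem; exact: GF.
apply/seteqP; split=> x.
  by move=> [c Pc Fcx]; exists (pickle c) => //; rewrite pickleK mem_set.
move=> [n _]; case: unpickle => // c; case: ifPn => // /set_mem Pc Fcx.
by exists c.
Qed.

Lemma setU_countType_closed (T : Type) (C : countType) (G : set (set T))
    (P : set C) (F : C -> set T) :
  G set0 -> (forall A : (set T)^nat, (forall n, G (A n)) -> G (\bigcup_n A n)) ->
  (forall c, P c -> G (F c)) -> G (\bigcup_(c in P) F c).
Proof. by move=> G0 GU GF; have [A GA ->] := bigcup_countType G0 GF; exact: GU. Qed.

Section closed_space_topology.
Context (R : realType) (d : nat) (A : closed_nonempty R d).
Implicit Types (U : set (closed_space A)).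

Lemma coords_continuous : continuous (@coords R d A).
Proof. exact: initial_continuous. Qed.

Lemma coords_entry_continuous (j : 'I_d) :
  continuous (fun x : closed_space A => coords x ord0 j).
Proof.
move=> x; apply: (@continuous_comp _ _ _ (@coords R d A)
  (fun y : 'rV[R]_d => y ord0 j : R)); first exact: coords_continuous.
exact: coord_continuous.
Qed.

Lemma closed_space_base (x : closed_space A) U : nbhs x U ->
  exists q k, open_box q k (coords x) /\ @coords R d A @^-1` closed_box q k `<=` U.
Proof.
move=> [_ [[V oV <-] /= Vx] VU].
have [q [k [qx qV]]] := rational_box_base (open_nbhs_nbhs (conj oV Vx)).
by exists q, k; split=> // y qy; apply: VU; exact: qV.
Qed.

Lemma open_bigcup_closed U : open U ->
  exists2 F : (set (closed_space A))^nat, forall n, closed (F n) & U = \bigcup_n F n.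
Proof.
move=> oU; pose box (c : 'rV[rat]_d * nat) := @coords R d A @^-1` closed_box c.1 c.2.
have UE : U = \bigcup_(c in [set c | box c `<=` U]) box c.
  apply/seteqP; split=> x; last by move=> [c /= cU] /cU.
  move=> Ux; have [q [k [qx qU]]] := closed_space_base (open_nbhs_nbhs (conj oU Ux)).
  by exists (q, k) => //; exact: open_box_sub.
have closed_box_c c : [set c | box c `<=` U] c -> closed (box c).
  move=> _; apply: preimage_closed; last exact: closed_closed_box.
  by move=> y _; exact: coords_continuous.
have [F cF FE] := bigcup_countType (@closed0 _) closed_box_c.
by exists F => //; rewrite UE.
Qed.

(** A cluster point of the image of a filter on [A] belongs to [A] because [A] is
    closed in R^d. *)
Lemma compact_coords_preimage (K : set 'rV[R]_d) :
  compact K -> compact (@coords R d A @^-1` K).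
Proof.
move=> cK F FF FK.
have cKA : compact (K `&` A) by apply: compact_closedI => //; exact: cn_closed.
have [|p [[Kp Ap] clp]] := cKA (@coords R d A @ F).
  apply: (@filterS _ F _ (@coords R d A @^-1` K)) FK => x Kx; split => //.
  exact: set_valP.
exists (SigSub (mem_set Ap)); split=> // B V FB [_ [[W oW <-] /= Wp] WV].
have FB' : (@coords R d A @ F) (@coords R d A @` B).
  by apply: (@filterS _ F _ B) FB => y By; exists y.
have [_ [[y By <-] Wy]] := clp _ _ FB' (open_nbhs_nbhs (conj oW Wp)).
by exists y; split => //; exact: WV.
Qed.

Lemma sigma_compact_closed_space : exists K : (set (closed_space A))^nat,
  [/\ forall n, compact (K n), forall n, closed (K n), nondecreasing_seq K &
      \bigcup_n K n = setT].
Proof.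
pose B n := [set x : 'rV[R]_d | forall j, `|x ord0 j| <= n%:R].
have cB n : closed (B n).
  rewrite (_ : B n = [set x | forall j, `|x ord0 j - 0| <= n%:R]).
    exact: closed_entry_dist_le.
  by apply/seteqP; split=> x Bx j; have := Bx j; rewrite subr0.
exists (fun n => @coords R d A @^-1` B n); split.
- move=> n; apply: compact_coords_preimage; apply: bounded_closed_compact => //.
  exists n%:R; split=> // M nM x Bx; rewrite /Num.norm/= mx_normrE.
  apply/bigmax_leP; split; first by rewrite ltW// (le_lt_trans _ nM).
  by move=> [i j] _; rewrite (ord1 i) (le_trans (Bx j))// ltW.
- by move=> n; apply: preimage_closed => // y _; exact: coords_continuous.
- by move=> m n mn; apply/subsetPset => x Bx j; rewrite (le_trans (Bx j))// ler_nat.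
- apply/seteqP; split=> // x _.
  have [n xn] : exists n, `|coords x| <= n%:R by exists (Num.bound `|coords x|);
    rewrite ltW// archi_boundP.
  exists n => // j; rewrite (le_trans _ xn)// [leRHS]/Num.norm/= mx_normrE.
  exact: (le_bigmax _ (fun ij => `|coords x ij.1 ij.2|) (ord0, j)).
Qed.

End closed_space_topology.

Lemma continuous_borel_measurable (R : realType) (E : ptopologicalType) (f : E -> R) :
  continuous f -> measurable_fun [set: g_sigma_algebraType (@open E)] f.
Proof.
move=> /continuousP cf; apply: (measurability _ (RGenOpens.measurableE R)).
move=> _ [_ [a [b ->] <-]]; rewrite setTI; apply: sub_sigma_algebra.
exact/cf/interval_open.
Qed.

Section path_space_topology.
Context (R : realType) (d : nat) (T : option nat).
Variable X : time_index T -> closed_nonempty R d.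
Implicit Types (U : set (path_space X)).

Lemma coord_proj_continuous n : continuous (@coord_proj R d T X n).
Proof. exact: (@proj_continuous (time_index T) (fun n => closed_space (X n)) n). Qed.

Definition cylinder (s : seq (time_index T * ('rV[rat]_d * nat))) : set (path_space X) :=
  [set x | forall c, c \in s ->
    open_box c.2.1 c.2.2 (coords (coord_proj c.1 x))].

Lemma cylinder_cat s t : cylinder (s ++ t) = cylinder s `&` cylinder t.
Proof.
apply/seteqP; split=> x => [xst|[xs xt] c].
  by split=> c cs; apply: xst; rewrite mem_cat cs ?orbT.
by rewrite mem_cat => /orP[/xs|/xt].
Qed.

Lemma cylinder_cons c s : cylinder (c :: s) =
  (fun x => coords (coord_proj c.1 x)) @^-1` open_box c.2.1 c.2.2 `&` cylinder s.
Proof.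
apply/seteqP; split=> x => [xcs|[xc xs] c'].
  by split=> [|c' c's]; apply: xcs; rewrite inE ?eqxx// c's orbT.
by rewrite inE => /predU1P[->|/xs].
Qed.

Lemma open_cylinder s : open (cylinder s).
Proof.
elim: s => [|c s IH].
  by have -> : cylinder [::] = setT by [apply/seteqP; split]; exact: openT.
rewrite cylinder_cons; apply: openI => //; apply: open_comp; last exact: open_open_box.
move=> x _; apply: (@continuous_comp _ _ _ (@coord_proj R d T X c.1) (@coords R d (X c.1))).
  exact: coord_proj_continuous.
exact: coords_continuous.
Qed.

(** The product topology is a supremum of initial topologies, so that it suffices
    to see that the filter generated by the cylinders around [x] converges to
    [x] in each coordinate. *)
Lemma path_space_base (x : path_space X) U : nbhs x U ->
  exists s, cylinder s x /\ cylinder s `<=` U.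
Proof.
pose F := [set V : set (path_space X) | exists s, cylinder s x /\ cylinder s `<=` V].
have FF : Filter F.
  split; first by exists [::].
    move=> V W [s [xs sV]] [t [xt tW]]; exists (s ++ t).
    by rewrite cylinder_cat; split=> // y [/sV ? /tW].
  by move=> V W VW [s [xs sV]]; exists s; split=> //; exact: subset_trans VW.
suff : nbhs x `<=` F by exact.
have [_ cvgF] := @cvg_sup (path_space X) _ (fun i => Topological.class
  (initial_topology (fun f : forall i, closed_space (X i) => f i))) F x FF.
apply: cvgF => i V [_ [[W oW <-] /= Wx] WV].
have [q [k [xqk qkW]]] := closed_space_base (open_nbhs_nbhs (conj oW Wx)).
exists [:: (i, (q, k))]; split=> [c|y yc].
  by rewrite inE => /eqP ->.
apply: WV; apply: qkW; apply: open_box_sub.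
by apply: (yc (i, (q, k))); rewrite inE.
Qed.

Lemma open_bigcup_cylinder U : open U ->
  U = \bigcup_(s in [set s | cylinder s `<=` U]) cylinder s.
Proof.
move=> oU; apply/seteqP; split=> x; last by move=> [s sU] /sU.
move=> Ux; have [s [xs sU]] := path_space_base (open_nbhs_nbhs (conj oU Ux)).
by exists s.
Qed.

Lemma compact_product (K : forall n, set (closed_space (X n))) :
  (forall n, compact (K n)) ->
  compact [set x : path_space X | forall n, K n (coord_proj n x)].
Proof. exact: tychonoff. Qed.

Lemma measurable_open_path U : open U -> measurable U.
Proof. exact: sub_sigma_algebra. Qed.

Lemma measurable_coord_proj n : measurable_fun setT (@coord_proj R d T X n).
Proof.
apply: (@measurability _ _ _ _ _ _ (@open (closed_space (X n)))) => //.
move=> _ [V oV <-]; rewrite setTI; apply: measurable_open_path.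
by apply: open_comp => // x _; exact: coord_proj_continuous.
Qed.

Lemma measurable_coords_entry n (j : 'I_d) :
  measurable_fun setT (fun x : closed_space (X n) => coords x ord0 j).
Proof.
apply: (@continuous_borel_measurable _ (closed_space (X n))).
exact: coords_entry_continuous.
Qed.

End path_space_topology.

(** * Static positions *)

Lemma esum_countType (R : realType) (C : countType) (a : C -> \bar R) :
  (forall c, 0 <= a c)%E ->
  (\esum_(c in [set: C]) a c = \sum_(k <oo) oapp a 0 (pickle_inv k))%E.
Proof.
move=> a0; have b0 k : (0 <= oapp a 0 (@pickle_inv C k))%E by case: pickle_inv.
rewrite nneseries_esumT//.
transitivity (\esum_(k in pickle @` [set: C]) oapp a 0 (@pickle_inv C k))%E.
  rewrite esum_image; last by move=> c c' _ _; exact: (pcan_inj (@pickleK_inv C)).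
  by apply: eq_esum => c _; rewrite pickleK_inv.
rewrite esum_mkcond; apply: eq_esum => k _; case: ifPn => // /negP kC.
case E : (pickle_inv k) => [c|//]; exfalso; apply: kC; rewrite inE.
by exists c => //; have := @pickle_invK C k; rewrite E.
Qed.

Lemma esum_countTypeZl (R : realType) (C : countType) (r : R) (a : C -> \bar R) :
  (forall c, 0 <= a c)%E -> 0 <= r ->
  (\esum_(c in [set: C]) (r%:E * a c) = r%:E * \esum_(c in [set: C]) a c)%E.
Proof.
move=> a0 r0; rewrite !esum_countType//; last by move=> c; rewrite mule_ge0.
rewrite -nneseriesZl; last by move=> k _; case: pickle_inv.
by apply: eq_eseriesr => k _; case: pickle_inv => //=; rewrite mule0.
Qed.

Lemma esum_countType_ge (R : realType) (C : countType) (a : C -> \bar R) c :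
  (forall c, 0 <= a c)%E -> (a c <= \esum_(c in [set: C]) a c)%E.
Proof.
move=> a0; apply: esum_ge; exists [set c]; first by split.
by rewrite fsbig_set1.
Qed.

Section static_positions.
Context (R : realType) (d : nat) (T : option nat).
Variable X : time_index T -> closed_nonempty R d.
Variable nu : forall n, probability (closed_space (X n)) R.
Implicit Types (f g : forall n, closed_space (X n) -> R) (x : path_space X).

Lemma oplus_ge0 g x : (forall n, Bpos (g n)) -> (0 <= oplus g x)%E.
Proof. by move=> Bg; apply: esum_ge0 => n _; rewrite lee_fin; apply: (Bg n).2. Qed.

Lemma le_oplus g n x : (forall n, Bpos (g n)) ->
  ((g n (coord_proj n x))%:E <= oplus g x)%E.
Proof.
move=> Bg; apply: (esum_countType_ge (a := fun n => (g n (coord_proj n x))%:E)) => k.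
by rewrite lee_fin; apply: (Bg k).2.
Qed.

Lemma oplusD f g x : (forall n, Bpos (f n)) -> (forall n, Bpos (g n)) ->
  oplus (fun n y => f n y + g n y) x = (oplus f x + oplus g x)%E.
Proof.
move=> Bf Bg; rewrite /oplus -esumD//.
- by move=> n _; rewrite lee_fin; apply: (Bf n).2.
- by move=> n _; rewrite lee_fin; apply: (Bg n).2.
Qed.

Lemma oplusZ (r : R) g x : (forall n, Bpos (g n)) -> 0 <= r ->
  oplus (fun n y => r * g n y) x = (r%:E * oplus g x)%E.
Proof.
move=> Bg r0; rewrite /oplus -esum_countTypeZl// => n.
by rewrite lee_fin; apply: (Bg n).2.
Qed.

Lemma integral_Bpos_ge0 g n : (forall n, Bpos (g n)) ->
  (0 <= \int[nu n]_x (g n x)%:E)%E.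
Proof. by move=> Bg; apply: integral_ge0 => y _; rewrite lee_fin; apply: (Bg n).2. Qed.

Lemma static_cost_ge0 g : (forall n, Bpos (g n)) -> (0 <= static_cost nu g)%E.
Proof. by move=> Bg; apply: esum_ge0 => n _; exact: integral_Bpos_ge0. Qed.

Lemma static_costD f g : (forall n, Bpos (f n)) -> (forall n, Bpos (g n)) ->
  static_cost nu (fun n y => f n y + g n y) = (static_cost nu f + static_cost nu g)%E.
Proof.
move=> Bf Bg; rewrite /static_cost -esumD; last 2 first.
- by move=> n _; exact: integral_Bpos_ge0.
- by move=> n _; exact: integral_Bpos_ge0.
apply: eq_esum => n _; under eq_integral do rewrite EFinD.
rewrite ge0_integralD//.
- by move=> y _; rewrite lee_fin; apply: (Bf n).2.
- by apply/measurable_EFinP; apply: (Bf n).1.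
- by move=> y _; rewrite lee_fin; apply: (Bg n).2.
- by apply/measurable_EFinP; apply: (Bg n).1.
Qed.

Lemma static_costZ (r : R) g : (forall n, Bpos (g n)) -> 0 <= r ->
  static_cost nu (fun n y => r * g n y) = (r%:E * static_cost nu g)%E.
Proof.
move=> Bg r0; rewrite /static_cost -esum_countTypeZl//; last first.
  by move=> n; exact: integral_Bpos_ge0.
apply: eq_esum => n _; under eq_integral do rewrite EFinM.
rewrite ge0_integralZl_EFin//.
- by move=> y _; rewrite lee_fin; apply: (Bg n).2.
- by apply/measurable_EFinP; apply: (Bg n).1.
Qed.

Lemma BposD n (f g : closed_space (X n) -> R) :
  Bpos f -> Bpos g -> Bpos (fun y => f y + g y).
Proof.
move=> [mf f0] [mg g0]; split; first exact: measurable_funD.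
by move=> y; rewrite addr_ge0.
Qed.

Lemma BposZ n (r : R) (g : closed_space (X n) -> R) :
  0 <= r -> Bpos g -> Bpos (fun y => r * g y).
Proof.
move=> r0 [mg g0]; split; first exact: measurable_funM.
by move=> y; rewrite mulr_ge0.
Qed.

Lemma static_positionD f g : static_position nu f -> static_position nu g ->
  static_position nu (fun n y => f n y + g n y).
Proof.
move=> [Bf cf] [Bg cg]; split=> [n|]; first exact: BposD.
by rewrite static_costD// lte_add_pinfty.
Qed.

Lemma static_positionZ (r : R) g : 0 <= r -> static_position nu g ->
  static_position nu (fun n y => r * g n y).
Proof.
move=> r0 [Bg cg]; split=> [n|]; first exact: BposZ.
by rewrite static_costZ// lte_mul_pinfty// lee_fin.
Qed.

Lemma static_cost_fin_num g : static_position nu g -> static_cost nu g \is a fin_num.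
Proof. by move=> [Bg cg]; rewrite ge0_fin_numE// static_cost_ge0. Qed.

Lemma oplus_series g x : (forall n, Bpos (g n)) -> oplus g x =
  (\sum_(k <oo) oapp (fun n => (g n (coord_proj n x))%:E) 0 (pickle_inv k))%E.
Proof.
by move=> Bg; rewrite -esum_countType// => n; rewrite lee_fin; apply: (Bg n).2.
Qed.

Lemma measurable_oapp_coord_proj g (o : option (time_index T)) :
  (forall n, Bpos (g n)) -> measurable_fun setT
  (fun x : path_space X => oapp (fun n => (g n (coord_proj n x))%:E) 0%E o).
Proof.
move=> Bg; case: o => [n|] /=; last exact: measurable_cst.
apply/measurable_EFinP; apply: (measurableT_comp (Bg n).1).
exact: measurable_coord_proj.
Qed.

Lemma measurable_oplus g : (forall n, Bpos (g n)) ->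
  measurable_fun setT (oplus g : path_space X -> \bar R).
Proof.
move=> Bg; rewrite (funext (fun x => oplus_series x Bg)).
apply: ge0_emeasurable_sum => [k x _ _|k _]; last exact: measurable_oapp_coord_proj.
by case: pickle_inv => //= n; rewrite lee_fin; apply: (Bg n).2.
Qed.

Lemma integral_coord_proj (mu : probability (path_space X) R) n
    (u : closed_space (X n) -> \bar R) : Pnu nu mu ->
  measurable_fun setT u -> (forall y, 0 <= u y)%E ->
  (\int[mu]_x u (coord_proj n x) = \int[nu n]_y u y)%E.
Proof.
move=> mu_nu mu_ u0.
have := ge0_integral_pushforward (@measurable_coord_proj R d T X n) mu
  (@measurableT _ _) mu_ (fun y _ => u0 y).
rewrite preimage_setT => <-.
apply: eq_measure_integral => [|mp A mA _]; first exact: measurable_coord_proj.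
exact: mu_nu.
Qed.

Lemma integral_oplus (mu : probability (path_space X) R) g : Pnu nu mu ->
  (forall n, Bpos (g n)) -> (\int[mu]_x oplus g x = static_cost nu g)%E.
Proof.
move=> mu_nu Bg; under eq_integral do rewrite oplus_series//.
rewrite integral_nneseries//; last 2 first.
- by move=> k; exact: measurable_oapp_coord_proj.
- by move=> k x _; case: pickle_inv => //= n; rewrite lee_fin; apply: (Bg n).2.
rewrite /static_cost esum_countType; last by move=> n; exact: integral_Bpos_ge0.
apply: eq_eseriesr => k _; case: pickle_inv => [n|] /=; last by rewrite integral0.
apply: (integral_coord_proj mu_nu (u := EFin \o g n)).
  by apply/measurable_EFinP; apply: (Bg n).1.
by move=> y; rewrite lee_fin; apply: (Bg n).2.
Qed.

End static_positions.

(** * Staircase approximation and truncated martingale transforms *)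

Section staircase.
Context (R : realType).
Implicit Types (u h : R) (N : nat).

Lemma staircase_bounds h u N : 0 <= h -> 0 <= u <= N%:R * h ->
  u - h <= \sum_(i < N) h * (i.+1%:R * h <= u)%R%:R <= u.
Proof.
move=> h0 /andP[u0 uN].
have full n : n%:R * h <= u -> \sum_(i < n) h * (i.+1%:R * h <= u)%R%:R = n%:R * h.
  elim: n => [|n IH] nu; first by rewrite big_ord0 mul0r.
  rewrite big_ord_recr/= nu IH; first by rewrite mulr1 -natr1 mulrDl mul1r.
  by apply: le_trans nu; rewrite ler_wpM2r// ler_nat.
elim: N uN => [|n IH] uN.
  have -> : u = 0 by apply/eqP; rewrite eq_le u0 andbT (le_trans uN)// mul0r.
  by rewrite big_ord0 lexx andbT sub0r oppr_le0.
have [un|un] := leP u (n%:R * h).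
  rewrite big_ord_recr/=; have [nu|_] := leP (n.+1%:R * h) u; last by rewrite mulr0 addr0 IH.
  by rewrite (full n) ?mulr1; [rewrite -natr1 mulrDl mul1r in nu uN *; lra|
    rewrite (le_trans _ nu)// ler_wpM2r// ler_nat].
rewrite big_ord_recr/= (full n (ltW un)).
have [nu|_] := leP (n.+1%:R * h) u; rewrite ?mulr1 ?mulr0 -natr1 mulrDl mul1r in uN *.
  by rewrite -natr1 mulrDl mul1r in nu; lra.
by lra.
Qed.

(** Level sets reduce statements on bounded functions to indicators. *)
Lemma staircase (T : Type) (f : T -> R) (c : R) N : (0 < N)%N ->
  (forall x, `|f x| <= c) ->
  let h := c *+ 2 / N%:R in
  let t i := i.+1%:R * h - c in
  forall x, f x - h <= - c + \sum_(i < N) h * \1_[set y | t i <= f y] x <= f x.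
Proof.
move=> N0 fc h t x.
have := fc x; rewrite ler_norml => /andP[cf fc'].
have c0 : 0 <= c by apply: le_trans (fc x).
have h0 : 0 <= h by rewrite divr_ge0// mulrn_wge0.
have Nh : N%:R * h = c *+ 2 by rewrite mulrC divfK// pnatr_eq0 -lt0n.
have /(staircase_bounds h0) : 0 <= f x + c <= N%:R * h.
  by rewrite Nh mulr2n lerD2r fc' andbT; lra.
have -> : \sum_(i < N) h * (i.+1%:R * h <= f x + c)%R%:R =
    \sum_(i < N) h * \1_[set y | t i <= f y] x.
  apply: eq_bigr => i _; rewrite indicE; congr (h * (nat_of_bool _)%:R).
    by apply/idP/idP; rewrite inE /= /t lerBlDr.
by move=> /andP[]; lra.
Qed.

End staircase.

Lemma le0_of_nat_bound (R : realType) (a b : R) :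
  (forall N, (0 < N)%N -> a <= b / N%:R) -> a <= 0.
Proof.
move=> ab; rewrite leNgt; apply/negP => a0.
have b0 : 0 <= b by rewrite -[b]divr1 (le_trans (ltW a0))// (ab 1%N).
have /archi_boundP := divr_ge0 b0 (ltW a0); set N := Num.bound _.
rewrite ltr_pdivrMr// => bN; have N0 : (0 < N)%N.
  by rewrite lt0n; apply/eqP => N0; move: bN; rewrite N0 mul0r ltNge b0.
have := ab N N0; rewrite ler_pdivlMr ?ltr0n// mulrC => Na.
by have := lt_le_trans bN Na; rewrite ltxx.
Qed.

Section expectation.
Context dsp (E : measurableType dsp) (R : realType) (mu : probability E R).
Implicit Types (f g : E -> R) (A : set E).

Notation integrable_fun f := (mu.-integrable setT (EFin \o f)).

Lemma integrable_bounded f c : measurable_fun setT f -> (forall x, `|f x| <= c) ->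
  integrable_fun f.
Proof.
move=> mf fc; apply: measurable_bounded_integrable => //.
  by rewrite (le_lt_trans (probability_le1 mu _))// ltry.
by exists c; split; [exact: num_real|] => M cM x _; exact: le_trans (fc x) (ltW cM).
Qed.

Lemma integrable_dominated f g : measurable_fun setT f -> integrable_fun g ->
  (forall x, `|f x| <= `|g x|) -> integrable_fun f.
Proof.
move=> mf ig fg; apply: (le_integrable measurableT) ig; first exact/measurable_EFinP.
by move=> x _; rewrite lee_fin.
Qed.

Lemma integrable_indicM f A : measurable A -> integrable_fun f ->
  integrable_fun (fun x => f x * \1_A x).
Proof.
move=> mA intf; apply: (integrable_dominated _ intf).
  by apply: measurable_funM => //; apply/measurable_EFinP; exact: measurable_int intf.
by move=> x; rewrite normrM indicE; case: (x \in A); rewrite ?normr1 ?mulr1// normr0 mulr0.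
Qed.

Lemma integral_indicM f A : measurable A ->
  (\int[mu]_(x in A) (f x)%:E = \int[mu]_x (f x * \1_A x)%:E)%E.
Proof.
move=> mA; rewrite integral_mkcond; apply: eq_integral => x _.
by rewrite patchE indicE; case: ifP; rewrite ?mulr1 ?mulr0.
Qed.

Lemma Rintegral_cst_probability r : \int[mu]_x r = r.
Proof.
rewrite Rintegral_cst// -[RHS]mulr1; congr (_ * _).
by rewrite -[RHS]/(fine 1%E); congr fine; exact: probability_setT.
Qed.

Lemma Rintegral_indicZ r A : measurable A ->
  \int[mu]_x (r * \1_A x) = r * fine (mu A).
Proof.
move=> mA; rewrite RintegralZl//; last exact: integrable_indic.
by rewrite /Rintegral integral_indic// setIT.
Qed.

Lemma Rintegral_sum (I : Type) (s : seq I) (Z : I -> E -> R) :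
  (forall i, integrable_fun (Z i)) ->
  integrable_fun (fun x => \sum_(i <- s) Z i x) /\
  \int[mu]_x (\sum_(i <- s) Z i x) = \sum_(i <- s) \int[mu]_x Z i x.
Proof.
move=> iZ; elim: s => [|i s [IHi IHs]].
  rewrite big_nil (_ : (fun x => _) = cst 0); last by apply/funext => x; rewrite big_nil.
  by split; [exact: integrable0|rewrite Rintegral_cst// mul0r].
rewrite big_cons (_ : (fun x => _) = (fun x => Z i x + \sum_(j <- s) Z j x)).
  by split; [exact: (integrableD measurableT (iZ i) IHi)|rewrite RintegralD// IHs].
by apply/funext => x; rewrite big_cons.
Qed.

(** Bounded functions are uniform limits of staircases over their level sets. *)
Lemma Rintegral_mul_eq0 (H Y : E -> R) (c : R) :
  measurable_fun setT H -> (forall x, `|H x| <= c) -> integrable_fun Y ->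
  \int[mu]_x Y x = 0 ->
  (forall t, \int[mu]_x (Y x * \1_[set y | t <= H y] x) = 0) ->
  \int[mu]_x (H x * Y x) = 0.
Proof.
move=> mH Hc iY Y0 YH0.
have mY : measurable_fun setT Y by apply/measurable_EFinP; exact: measurable_int iY.
have iHY : integrable_fun (fun x => H x * Y x).
  apply: (integrable_dominated (g := fun x => c * Y x)).
  - exact: measurable_funM.
  - exact: (integrableZl measurableT c iY).
  - by move=> x; rewrite !normrM ler_wpM2r// (le_trans (Hc x))// ler_norm.
have mlevel t : measurable [set y | t <= H y].
  by rewrite -[X in measurable X]setTI; exact: measurable_fun_le.
suff : `|\int[mu]_x (H x * Y x)| <= 0 by rewrite normr_le0 => /eqP.
apply: (@le0_of_nat_bound _ _ (c *+ 2 * \int[mu]_x `|Y x|)) => N N0.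
pose h := c *+ 2 / N%:R; pose t i := i.+1%:R * h - c.
pose s x := - c + \sum_(i < N) h * \1_[set y | t i <= H y] x.
have sP x : H x - h <= s x <= H x := staircase N0 Hc x.
have h0 : 0 <= h by have := sP point; lra.
have isY : integrable_fun (fun x => s x * Y x) /\ \int[mu]_x (s x * Y x) = 0.
  pose Z i x := h * (Y x * \1_[set y | t i <= H y] x).
  have iZ i : integrable_fun (Z i).
    exact: (integrableZl measurableT h (integrable_indicM (mlevel (t i)) iY)).
  have Z0 i : \int[mu]_x Z i x = 0.
    by rewrite RintegralZl ?YH0 ?mulr0//; exact: integrable_indicM.
  have [iS S0] := @Rintegral_sum _ (index_enum 'I_N) (fun i => Z i) (fun i => iZ i).
  have sE : (fun x => s x * Y x) = (fun x => - c * Y x + \sum_(i < N) Z i x).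
    apply/funext => x; rewrite mulrDl mulr_suml; congr (_ + _).
    by apply: eq_bigr => i _; rewrite /Z mulrAC mulrA.
  have icY : integrable_fun (fun x => - c * Y x) by exact: (integrableZl measurableT (- c) iY).
  rewrite sE; split; first exact: (integrableD measurableT icY iS).
  by rewrite RintegralD// RintegralZl// Y0 mulr0 add0r S0 big1.
have -> : \int[mu]_x (H x * Y x) = \int[mu]_x ((H x - s x) * Y x).
  under [RHS]eq_Rintegral do rewrite mulrBl.
  by rewrite RintegralB ?isY.2 ?subr0//; exact: isY.1.
rewrite -mulrAC -/h -RintegralZl//; last exact: integrable_norm.
have iHs : integrable_fun (fun x => (H x - s x) * Y x).
  have := integrableB measurableT iHY isY.1; apply: eq_integrable => // x _.
  by rewrite /= -EFinB mulrBl.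
apply: (le_trans (le_normr_Rintegral measurableT iHs)).
apply: le_Rintegral => //.
- exact: (integrable_norm iHs).
- exact: (integrableZl measurableT h (integrable_norm iY)).
- move=> x _; rewrite normrM ler_wpM2r// ger0_norm; have := sP x; lra.
Qed.

(** The sets on which the two integrals agree form a Dynkin system. *)
Lemma eq_integral_pi_system (P : set (set E)) f g : setI_closed P -> P setT ->
  P `<=` measurable -> integrable_fun f -> integrable_fun g ->
  (forall A, P A -> \int[mu]_(x in A) (f x)%:E = \int[mu]_(x in A) (g x)%:E)%E ->
  forall A, <<s P >> A ->
  (\int[mu]_(x in A) (f x)%:E = \int[mu]_(x in A) (g x)%:E)%E.
Proof.
move=> PI PT Pm intf intg fg.
pose G := [set A | measurable A /\
  (\int[mu]_(x in A) (f x)%:E = \int[mu]_(x in A) (g x)%:E)%E].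
suff dynG : dynkin G.
  rewrite -(setI_closed_g_dynkin_g_sigma_algebra PI) => A PA.
  have [] // : G A; apply: PA; split=> // B PB.
  by split; [exact: Pm|exact: fg].
split; first by split=> //; exact: fg.
- move=> A [mA fgA]; split; first exact: measurableC.
  have intC k : integrable_fun k ->
      (\int[mu]_(x in ~` A) (k x)%:E = \int[mu]_x (k x)%:E - \int[mu]_(x in A) (k x)%:E)%E.
    move=> intk; rewrite (@integral_indicM k A mA) (@integral_indicM k _ (measurableC mA)).
    rewrite -integralB_EFin//; last exact: integrable_indicM.
    apply: eq_integral => x _; rewrite -EFinB; congr EFin.
    by rewrite !indicE in_setC; case: (x \in A); rewrite ?mulr1 ?mulr0 ?subr0 ?subrr.
  by rewrite !intC// fgA (fg _ PT).
- move=> F tF GF; have mF n : measurable (F n) by case: (GF n).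
  split; first exact: bigcupT_measurable.
  rewrite !integral_bigcup//.
  + by apply: eq_eseriesr => n _; case: (GF n).
  + exact: (integrableS measurableT (bigcupT_measurable _ mF)).
  + exact: (integrableS measurableT (bigcupT_measurable _ mF)).
Qed.

(** One step of a truncated martingale transform. If [V] and [W] have the same
    integrals over sets that exhaust the space, and there also over
    [V < 0], then integrability of the negative part passes from [W]
    to [V], and the expectations of [V] and [W] agree in the form that makes
    sense as soon as the negative parts are integrable. *)
Lemma truncated_step (V W : E -> R) (D : (set E)^nat) :
  measurable_fun setT V -> measurable_fun setT W ->
  (forall k, measurable (D k)) -> nondecreasing_seq D -> \bigcup_k D k = setT ->
  (forall k, mu.-integrable (D k) (EFin \o V)) ->
  (forall k, mu.-integrable (D k) (EFin \o W)) ->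
  (forall k, \int[mu]_(x in D k) (V x)%:E = \int[mu]_(x in D k) (W x)%:E)%E ->
  (forall k, \int[mu]_(x in D k `&` [set y | (V y < 0)%R]) (V x)%:E =
             \int[mu]_(x in D k `&` [set y | (V y < 0)%R]) (W x)%:E)%E ->
  (\int[mu]_x (EFin \o W)^\- x < +oo)%E ->
  (\int[mu]_x (EFin \o V)^\- x < +oo /\
   \int[mu]_x (EFin \o V)^\+ x + \int[mu]_x (EFin \o W)^\- x =
   \int[mu]_x (EFin \o V)^\- x + \int[mu]_x (EFin \o W)^\+ x)%E.
Proof.
move=> mV mW mD ndD DT iV iW VW VWneg Wfin.
have mVE : measurable_fun setT (EFin \o V) by exact/measurable_EFinP.
have mWE : measurable_fun setT (EFin \o W) by exact/measurable_EFinP.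
have cvgD (f : E -> \bar R) : measurable_fun setT f -> (forall x, 0 <= f x)%E ->
    (\int[mu]_(x in D k) f x)%E @[k --> \oo] --> (\int[mu]_x f x)%E.
  move=> mf f0; rewrite -DT; apply: ge0_nondecreasing_set_cvg_integral => //.
  by move=> k; exact: measurable_funTS.
have mneg : measurable [set y | (V y < 0)%R].
  rewrite (_ : mkset _ = ~` [set y | 0 <= V y]).
    by apply: measurableC; rewrite -[X in measurable X]setTI; exact: measurable_fun_le.
  by apply/seteqP; split=> x /=; rewrite ltNge => /negP.
split.
  apply: le_lt_trans Wfin; apply: (cvge_to_le (cvgD _ _ _)).
  - exact: measurable_funeneg.
  - by move=> x; exact: funeneg_ge0.
  apply: nearW => k.
  have := VWneg k; set A := D k `&` _.
  have mA : measurable A by exact: measurableI.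
  have -> : (\int[mu]_(x in D k) (EFin \o V)^\- x = \int[mu]_(x in A) (EFin \o V)^\- x)%E.
    rewrite /A integral_mkcondr; apply: eq_integral => x _; rewrite patchE.
    case: ifPn => // /negP; rewrite inE/= => /negP; rewrite -leNgt => V0.
    by rewrite funenegE/= maxEle lee_fin oppr_le0 V0.
  rewrite (integralE _ _ (fun x => (V x)%:E)) (integralE _ _ (fun x => (W x)%:E)).
  have -> : (\int[mu]_(x in A) (fun x => (V x)%:E)^\+ x = 0)%E.
    apply: integral0_eq => x [_ /=] /ltW V0.
    by rewrite funeposE maxEle lee_fin V0.
  rewrite sub0e => VWA; apply: (@le_trans _ _ (\int[mu]_(x in A) (EFin \o W)^\- x)%E).
    rewrite -leeN2 VWA leeDr// integral_ge0// => x _; exact: funepos_ge0.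
  apply: ge0_subset_integral => //; first exact: measurable_funeneg.
have eq_step (p q r s : \bar R) : (p \is a fin_num -> q \is a fin_num -> r \is a fin_num ->
    s \is a fin_num -> p - q = r - s -> p + s = q + r)%E.
  case: p q r s => [p| |] [q| |] [r| |] [s| |]// _ _ _ _ [] pqrs; congr EFin.
  by lra.
have cvg_sum (f g : E -> \bar R) : measurable_fun setT f -> measurable_fun setT g ->
    (forall x, 0 <= f x)%E -> (forall x, 0 <= g x)%E ->
    (\int[mu]_(x in D k) f x + \int[mu]_(x in D k) g x)%E @[k --> \oo] -->
    (\int[mu]_x f x + \int[mu]_x g x)%E.
  move=> mf mg f0 g0; apply: cvgeD; [|exact: cvgD|exact: cvgD].
  by apply: ge0_adde_def; rewrite inE integral_ge0.
have VWk k : (\int[mu]_(x in D k) (EFin \o V)^\+ x + \int[mu]_(x in D k) (EFin \o W)^\- x =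
    \int[mu]_(x in D k) (EFin \o V)^\- x + \int[mu]_(x in D k) (EFin \o W)^\+ x)%E.
  apply: eq_step.
  - exact: integrable_pos_fin_num.
  - exact: integrable_neg_fin_num.
  - exact: integrable_pos_fin_num.
  - exact: integrable_neg_fin_num.
  - by rewrite -!integralE; exact: VW.
have V1 := cvg_sum _ _ (measurable_funepos mVE) (measurable_funeneg mWE)
  (funepos_ge0 _) (funeneg_ge0 _).
have V2 := cvg_sum _ _ (measurable_funeneg mVE) (measurable_funepos mWE)
  (funeneg_ge0 _) (funepos_ge0 _).
rewrite -(cvg_lim (@ereal_hausdorff R) V1) -(cvg_lim (@ereal_hausdorff R) V2).
by under eq_fun do rewrite VWk.
Qed.

End expectation.

(** * Filtration and trading gains *)

Lemma measurable_sub_sigma_algebra d' (E : pointedType) (F : measurableType d')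
    (C C' : set (set E)) (f : E -> F) : <<s C >> `<=` <<s C' >> ->
  measurable_fun [set: g_sigma_algebraType C] f ->
  measurable_fun [set: g_sigma_algebraType C'] f.
Proof. by move=> CC' mf _ B mB; apply: CC'; exact: mf. Qed.

Section borel_vectors.
Context (R : realType) (d : nat) dsp (E : measurableType dsp).

Lemma measurable_entry (f : E -> borel_rV R d) (j : 'I_d) :
  measurable_fun setT f -> measurable_fun setT (fun x => (f x : 'rV[R]_d) ord0 j).
Proof.
move=> mf.
have me : measurable_fun [set: borel_rV R d] (fun y : 'rV[R]_d => y ord0 j).
  by apply: (@continuous_borel_measurable _ 'rV[R]_d); exact: coord_continuous.
exact: (measurableT_comp me mf).
Qed.

(** Rational boxes form a countable base, so that entrywise measurability is
    enough. *)
Lemma measurable_vector (f : E -> borel_rV R d) :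
  (forall j, measurable_fun setT (fun x => (f x : 'rV[R]_d) ord0 j)) ->
  measurable_fun setT f.
Proof.
move=> mf; apply: (@measurability _ _ _ (borel_rV R d) _ _ (@open 'rV[R]_d)) => //.
move=> _ [V oV <-]; rewrite setTI.
pose box (c : 'rV[rat]_d * nat) := f @^-1` open_box c.1 c.2.
have -> : f @^-1` V = \bigcup_(c in [set c | open_box c.1 c.2 `<=` V]) box c.
  apply/seteqP; split=> x; last by move=> [c /= cV] /cV.
  move=> Vx; have [q [k [qx qV]]] := rational_box_base (open_nbhs_nbhs (conj oV Vx)).
  by exists (q, k) => //=; apply: subset_trans qV; exact: open_box_sub.
apply: (setU_countType_closed measurable0 (@bigcupT_measurable _ E)) => -[q k] _.
rewrite (_ : box _ = \bigcap_j
    [set x | `|(f x : 'rV[R]_d) ord0 j - ratr (q ord0 j)| < k.+1%:R^-1]).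
  apply: fin_bigcap_measurable => // j _.
  rewrite (_ : mkset _ = ~` [set x | k.+1%:R^-1 <=
      `|(f x : 'rV[R]_d) ord0 j - ratr (q ord0 j)|]); last first.
    by apply/seteqP; split=> x /=; rewrite ltNge => /negP.
  apply: measurableC; rewrite -[X in measurable X]setTI.
  apply: measurable_fun_le => //; apply: measurableT_comp => //.
  exact: measurable_funB.
by apply/seteqP; split=> x xb j; [move=> _|]; exact: xb.
Qed.

End borel_vectors.

Section filtration.
Context (R : realType) (d : nat) (T : option nat).
Variable X : time_index T -> closed_nonempty R d.
Variable s0 : 'rV[R]_d.

Local Notation F n := (filtration_gen (X := X) s0 n).

Lemma price_continuous n : continuous (price s0 n : path_space X -> 'rV[R]_d).
Proof.
case: n => [|n]; first by move=> x; exact: cst_continuous.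
rewrite /price; case: insub => [i|]; last by move=> x; exact: cst_continuous.
move=> x; apply: (@continuous_comp _ _ _ (@coord_proj R d T X i) (@coords R d (X i))).
  exact: coord_proj_continuous.
exact: coords_continuous.
Qed.

Lemma filtration_measurable n : <<s F n >> `<=` @measurable _ (path_space X).
Proof.
apply: smallest_sub; first exact: sigma_algebra_measurable.
move=> _ [k _ [B mB <-]]; rewrite setTI.
rewrite -[X in measurable X]setTI.
suff : measurable_fun [set: path_space X] (price s0 k : _ -> borel_rV R d) by exact.
apply: (@measurability _ _ _ (borel_rV R d) _ _ (@open 'rV[R]_d)) => //.
move=> _ [V oV <-]; rewrite setTI; apply: measurable_open_path.
by apply: open_comp => // x _; exact: price_continuous.
Qed.

Lemma filtration_le m n : (m <= n)%N -> <<s F m >> `<=` <<s F n >>.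
Proof.
move=> mn; apply: smallest_sub; first exact: smallest_sigma_algebra.
by move=> A [k km Ak]; apply: sub_sigma_algebra; exists k => //=; exact: leq_trans mn.
Qed.

Lemma measurable_filtration d' (E : measurableType d') n (f : path_space X -> E) :
  measurable_fun [set: g_sigma_algebraType (F n)] f -> measurable_fun setT f.
Proof. by move=> mf _ B mB; apply: filtration_measurable; exact: mf. Qed.

Lemma adapted_price m n : (m <= n)%N ->
  measurable_fun [set: g_sigma_algebraType (F n)] (price s0 m : _ -> borel_rV R d).
Proof. by move=> mn _ B mB; apply: sub_sigma_algebra; exists m => //; exists B. Qed.

Lemma adapted_price_entry m n (j : 'I_d) : (m <= n)%N ->
  measurable_fun [set: g_sigma_algebraType (F n)] (fun x => price s0 m x ord0 j).
Proof. by move=> mn; apply: measurable_entry; exact: adapted_price. Qed.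

(** Gains up to time [n] of a position [h] that is indexed like the entries of
    a dynamic strategy. *)
Definition gain (h : nat -> path_space X -> 'rV[R]_d) n (x : path_space X) : R :=
  \sum_(k < n) dotp (h k x) (price s0 k.+1 x - price s0 k x).

Lemma gainS h n x : gain h n.+1 x =
  gain h n x + \sum_(j < d) h n x ord0 j * (price s0 n.+1 x ord0 j - price s0 n x ord0 j).
Proof.
rewrite /gain big_ord_recr/=; congr (_ + _).
by apply: eq_bigr => j _; rewrite !mxE.
Qed.

Lemma adapted_gain h n :
  (forall k, (k < n)%N ->
    measurable_fun [set: g_sigma_algebraType (F k)] (h k : _ -> borel_rV R d)) ->
  measurable_fun [set: g_sigma_algebraType (F n)] (gain h n).
Proof.
elim: n => [|n IH] mh.
  by rewrite (_ : gain h 0 = cst 0)//; apply/funext => x; rewrite /gain big_ord0.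
rewrite (funext (gainS h n)); apply: measurable_funD.
  apply: (measurable_sub_sigma_algebra (filtration_le (leqnSn n))).
  by apply: IH => k kn; apply: mh; exact: ltnW.
apply: measurable_sum => j; apply: measurable_funM.
  apply: (measurable_sub_sigma_algebra (filtration_le (leqnSn n))).
  by apply: measurable_entry; exact: mh.
by apply: measurable_funB; exact: adapted_price_entry.
Qed.

End filtration.

Section martingale_gains.
Context (R : realType) (d : nat) (T : option nat).
Variable X : time_index T -> closed_nonempty R d.
Variables (s0 : 'rV[R]_d) (mu : probability (path_space X) R).
Hypothesis mart : martingale T mu (filtration_gen s0) (price s0).

Local Notation F n := (filtration_gen (X := X) s0 n).
Local Notation integrable_fun f := (mu.-integrable setT (EFin \o f)).

Lemma integrable_onE (D : set (path_space X)) (f : path_space X -> R) :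
  measurable D -> integrable_fun (fun x => f x * \1_D x) ->
  mu.-integrable D (EFin \o f).
Proof.
move=> mD intf; apply/(integrable_mkcond _ mD).
move: intf; apply: eq_integrable => // x _ /=.
by rewrite patchE indicE; case: ifP; rewrite ?mulr1 ?mulr0.
Qed.

Let increment n (j : 'I_d) (x : path_space X) : R :=
  price s0 n.+1 x ord0 j - price s0 n x ord0 j.

Lemma in_horizon_leq m n : (m <= n)%N -> in_horizon T n -> in_horizon T m.
Proof. by rewrite /in_horizon; case: T => // k; exact: leq_trans. Qed.

Lemma integrable_increment n j : in_horizon T n.+1 -> integrable_fun (increment n j).
Proof.
move=> nT; have [_ iS] := mart.1 n.+1 j nT.
have [_ iS'] := mart.1 n j (in_horizon_leq (leqnSn n) nT).
exact: (integrableB measurableT iS iS').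
Qed.

(** The level sets of a bounded [H] belong to [F n], and on them the increment
    has integral zero by the martingale property. *)
Lemma increment_orthogonal n j (H : path_space X -> R) (c : R) : in_horizon T n.+1 ->
  measurable_fun [set: g_sigma_algebraType (F n)] H -> (forall x, `|H x| <= c) ->
  integrable_fun (fun x => H x * increment n j x) /\
  \int[mu]_x (H x * increment n j x) = 0.
Proof.
move=> nT mH Hc; have iY := integrable_increment j nT.
have mHX := measurable_filtration mH.
have mY : measurable_fun setT (increment n j) by apply/measurable_EFinP; exact: measurable_int iY.
split.
  apply: (@integrable_dominated _ _ _ _ _ (fun x => c * increment n j x)).
  - exact: measurable_funM.
  - exact: (integrableZl measurableT c iY).
  - by move=> x; rewrite !normrM ler_wpM2r// (le_trans (Hc x))// ler_norm.
have incr0 A : <<s F n >> A -> \int[mu]_x (increment n j x * \1_A x) = 0.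
  move=> FA; have mA := filtration_measurable FA.
  have [_ iS] := mart.1 n.+1 j nT.
  have [_ iS'] := mart.1 n j (in_horizon_leq (leqnSn n) nT).
  have [_ _ /(_ A FA)] := mart.2 n j nT.
  rewrite !(@integral_indicM _ _ _ mu _ A mA) => SS'.
  under eq_Rintegral do rewrite mulrBl.
  rewrite RintegralB//; last 2 first.
  - exact: integrable_indicM.
  - exact: integrable_indicM.
  by rewrite /Rintegral SS' subrr.
apply: (Rintegral_mul_eq0 mHX Hc iY).
  rewrite -[RHS](incr0 setT); last exact: (@measurableT _ (g_sigma_algebraType (F n))).
  by apply: eq_Rintegral => x _; rewrite indicT mulr1.
move=> t; apply: incr0.
have := @measurable_fun_le _ (g_sigma_algebraType (F n)) _ setT (cst t) H measurableT.
by rewrite setTI; apply => //; exact: measurable_cst.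
Qed.

Variable h : nat -> path_space X -> 'rV[R]_d.
Variable N : nat.
Hypothesis NT : in_horizon T N.
Hypothesis mh : forall k, (k < N)%N ->
  measurable_fun [set: g_sigma_algebraType (F k)] (h k : _ -> borel_rV R d).

Lemma gain_truncated n (D : set (path_space X)) (c : R) : (n < N)%N -> <<s F n >> D ->
  (forall x, D x -> `|gain s0 h n x| <= c) ->
  (forall x j, D x -> `|h n x ord0 j| <= c) ->
  [/\ mu.-integrable D (EFin \o gain s0 h n),
      mu.-integrable D (EFin \o gain s0 h n.+1) &
      (\int[mu]_(x in D) (gain s0 h n x)%:E =
       \int[mu]_(x in D) (gain s0 h n.+1 x)%:E)%E].
Proof.
move=> nN FD Vc hc; have mD := filtration_measurable FD.
have nT : in_horizon T n.+1 by exact: in_horizon_leq NT.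
have mD1 : measurable_fun [set: g_sigma_algebraType (F n)] (\1_D : path_space X -> R).
  exact: (@measurable_indic _ (g_sigma_algebraType (F n)) R setT D).
have mV : measurable_fun [set: g_sigma_algebraType (F n)] (gain s0 h n).
  by apply: adapted_gain => k kn; apply: mh; exact: ltn_trans nN.
pose V x := gain s0 h n x * \1_D x.
have c0 x : D x -> 0 <= c by move=> Dx; exact: le_trans (Vc x Dx).
have on_D (f : path_space X -> R) : (forall x, D x -> `|f x| <= c) ->
    forall x, `|f x * \1_D x| <= `|c|.
  move=> fc x; rewrite indicE; case: (boolP (x \in D)) => [/set_mem Dx|_].
    by rewrite mulr1 (le_trans (fc x Dx))// ler_norm.
  by rewrite mulr0 normr0.
have iV : integrable_fun V.
  apply: (integrable_bounded mu _ (on_D _ Vc)).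
  exact: (measurable_filtration (measurable_funM mV mD1)).
pose Z j x := (h n x ord0 j * \1_D x) * increment n j x.
have ZP j : integrable_fun (Z j) /\ \int[mu]_x Z j x = 0.
  apply: (@increment_orthogonal n j _ `|c|) => //.
    by apply: measurable_funM => //; apply: measurable_entry; exact: mh.
  by apply: on_D => x; exact: hc.
have [iZ Z0] : integrable_fun (fun x => \sum_j Z j x) /\ \int[mu]_x (\sum_j Z j x) = 0.
  have [iZ ->] := Rintegral_sum (index_enum 'I_d) (fun j => (ZP j).1).
  by split=> //; rewrite big1// => j _; exact: (ZP j).2.
have WE x : gain s0 h n.+1 x * \1_D x = V x + \sum_j Z j x.
  rewrite gainS mulrDl; congr (_ + _); rewrite mulr_suml; apply: eq_bigr => j _.
  by rewrite /Z mulrAC.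
have iW : integrable_fun (fun x => gain s0 h n.+1 x * \1_D x).
  by rewrite (funext WE); exact: (integrableD measurableT iV iZ).
split; [exact: integrable_onE|exact: integrable_onE|].
rewrite !(@integral_indicM _ _ _ mu _ D mD) (eq_integral _ _ (fun x _ => congr1 EFin (WE x))).
under [RHS]eq_integral do rewrite EFinD.
rewrite integralD_EFin//; move/eqP: Z0.
rewrite /Rintegral fine_eq0; last exact: (integrable_fin_num measurableT iZ).
by move=> /eqP ->; rewrite adde0.
Qed.

Lemma integral_gain_step n : (n < N)%N ->
  (\int[mu]_x (EFin \o gain s0 h n.+1)^\- x < +oo)%E ->
  (\int[mu]_x (EFin \o gain s0 h n)^\- x < +oo /\
   \int[mu]_x (EFin \o gain s0 h n)^\+ x + \int[mu]_x (EFin \o gain s0 h n.+1)^\- x =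
   \int[mu]_x (EFin \o gain s0 h n)^\- x + \int[mu]_x (EFin \o gain s0 h n.+1)^\+ x)%E.
Proof.
move=> nN.
have mV k : (k <= N)%N -> measurable_fun [set: g_sigma_algebraType (F k)] (gain s0 h k).
  by move=> kN; apply: adapted_gain => i ik; apply: mh; exact: leq_trans kN.
(* on [D k] the past gains and the next position are bounded, as in [gain_truncated] *)
pose D k := [set x | `|gain s0 h n x| <= k%:R] `&`
  \bigcap_j [set x | `|h n x ord0 j| <= k%:R].
have mle (f : path_space X -> R) (r : R) :
    measurable_fun [set: g_sigma_algebraType (F n)] f ->
    <<s F n >> [set x | `|f x| <= r].
  move=> mf; have := @measurable_fun_le _ (g_sigma_algebraType (F n)) _ setT
    (fun x => `|f x|) (cst r) measurableT.
  by rewrite setTI; apply; [exact: measurableT_comp|exact: measurable_cst].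
have FD k : <<s F n >> (D k).
  apply: (@measurableI _ (g_sigma_algebraType (F n))).
    by apply: mle; apply: mV; exact: ltnW.
  apply: (@fin_bigcap_measurable _ (g_sigma_algebraType (F n))) => // j _.
  by apply: mle; apply: measurable_entry; exact: mh.
have Fneg : <<s F n >> [set y | gain s0 h n y < 0].
  rewrite (_ : mkset _ = ~` [set y | 0 <= gain s0 h n y]); last first.
    by apply/seteqP; split=> x /=; rewrite ltNge => /negP.
  apply: (@measurableC _ (g_sigma_algebraType (F n))).
  have := @measurable_fun_le _ (g_sigma_algebraType (F n)) _ setT
    (cst 0) (gain s0 h n) measurableT.
  by rewrite setTI; apply; [exact: measurable_cst|exact: mV (ltnW nN)].
have DV k x : D k x -> `|gain s0 h n x| <= k%:R by case.
have Dh k x j : D k x -> `|h n x ord0 j| <= k%:R by case=> _; exact.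
apply: (@truncated_step _ _ _ _ _ _ D).
- by apply: measurable_filtration; apply: mV; exact: ltnW.
- by apply: measurable_filtration; exact: mV.
- by move=> k; exact: filtration_measurable (FD k).
- move=> k l kl; apply/subsetPset => x [Vx hx]; split.
    by rewrite /= (le_trans Vx)// ler_nat.
  by move=> j _; rewrite /= (le_trans (hx j I))// ler_nat.
- apply/seteqP; split=> // x _.
  pose M := `|gain s0 h n x| + \sum_j `|h n x ord0 j|.
  have M0 : 0 <= M by rewrite addr_ge0// sumr_ge0.
  have [k Mk] : exists k, M <= k%:R.
    by exists (Num.bound M); rewrite ltW// archi_boundP.
  exists k => //; split; first by rewrite /= (le_trans _ Mk)// lerDl sumr_ge0.
  move=> j _; rewrite /= (le_trans _ Mk)// /M (bigD1 j)//= addrCA lerDl.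
  by rewrite addr_ge0// sumr_ge0.
- by move=> k; case: (gain_truncated nN (FD k) (DV k) (Dh k)).
- by move=> k; case: (gain_truncated nN (FD k) (DV k) (Dh k)).
- by move=> k; case: (gain_truncated nN (FD k) (DV k) (Dh k)).
- move=> k; have FDn := @measurableI _ (g_sigma_algebraType (F n)) _ _ (FD k) Fneg.
  by have [] := gain_truncated nN FDn (fun x Dx => DV k x Dx.1) (fun x j Dx => Dh k x j Dx.1).
Qed.

(** A gains process whose final value has an integrable negative part is a
    true martingale, although the position is unbounded. *)
Lemma integral_gain_eq0 n : (n <= N)%N ->
  (\int[mu]_x (EFin \o gain s0 h n)^\- x < +oo)%E ->
  (\int[mu]_x (EFin \o gain s0 h n)^\+ x = \int[mu]_x (EFin \o gain s0 h n)^\- x)%E.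
Proof.
elim: n => [_ _|n IH nN neg].
  rewrite (_ : EFin \o gain s0 h 0 = cst 0%E); last first.
    by apply/funext => x; rewrite /= /gain big_ord0.
  by rewrite !integral0_eq// => x _; rewrite ?funeposE ?funenegE ?oppe0 maxxx.
have [negn stepn] := integral_gain_step nN neg.
have posn := IH (ltnW nN) negn.
have fin : (\int[mu]_x (EFin \o gain s0 h n)^\- x)%E \is a fin_num.
  by rewrite ge0_fin_numE// integral_ge0// => x _; exact: funeneg_ge0.
have cancel (a b c : \bar R) : a \is a fin_num -> (a + b = a + c -> b = c)%E.
  by case: a b c => [a| |] [b| |] [c| |]//= _ [] /addrI ->.
by apply/esym; apply: cancel fin _; rewrite -stepn posn.
Qed.

End martingale_gains.

(** * Weak duality *)

Section weak_duality.
Context (R : realType) (d : nat) (T : option nat).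
Variable X : time_index T -> closed_nonempty R d.
Variable nu : forall n : time_index T, probability (closed_space (X n)) R.
Variables (s0 : 'rV[R]_d) (mu : probability (path_space X) R).
Hypothesis mu_M : Mnu nu s0 mu.
Local Open Scope ereal_scope.

Lemma integrable_oplus g : static_position nu g ->
  mu.-integrable setT (oplus g : path_space X -> \bar R).
Proof.
move=> [Bg cg]; apply/integrableP; split; first exact: measurable_oplus.
under eq_integral do rewrite gee0_abs ?oplus_ge0//.
by rewrite (integral_oplus mu_M.1).
Qed.

Lemma integrable_Bnu f : Bnu nu f -> mu.-integrable setT (EFin \o f).
Proof.
move=> [mf [_ [g posg <-] fg]].
apply: le_integrable (integrable_oplus posg) => //; first exact/measurable_EFinP.
by move=> x _ /=; rewrite gee0_abs ?fg// oplus_ge0//; exact: posg.1.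
Qed.

(** Integrability of the gains is part of the conclusion: only a lower bound is
    available beforehand. *)
Lemma integral_trading_gain h (Z : path_space X -> \bar R) : dynamic_strategy s0 h ->
  mu.-integrable setT Z -> (forall x, 0 <= Z x) ->
  (forall x, - Z x <= (trading_gain s0 h x)%:E) ->
  mu.-integrable setT (EFin \o trading_gain s0 h) /\
  \int[mu]_x (trading_gain s0 h x)%:E = 0.
Proof.
move=> [hT mh] iZ Z0 ZV; pose V := gain s0 (nth (fun=> 0%R) h) (size h).
have VE : trading_gain s0 h = V by [].
have mV : measurable_fun setT (EFin \o V).
  by apply/measurable_EFinP; apply: (measurable_filtration (adapted_gain mh)).
have negV : \int[mu]_x (EFin \o V)^\- x < +oo.
  apply: (@le_lt_trans _ _ (\int[mu]_x Z x)).
    apply: ge0_le_integral => //.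
    - exact: measurable_funeneg.
    - exact: measurable_int iZ.
    - by move=> x _; rewrite funenegE ge_max Z0 andbT leeNl -VE; exact: ZV.
  have /integrableP[_] := iZ.
  by under eq_integral do rewrite gee0_abs ?Z0//.
have posV := integral_gain_eq0 mu_M.2 hT mh (leqnn _) negV.
rewrite -/V in posV.
split; last first.
  rewrite VE integralE posV subee// ge0_fin_numE//.
  by rewrite integral_ge0// => x _; exact: funeneg_ge0.
rewrite VE; apply/integrableP; split=> //.
rewrite -/((abse \o (EFin \o V))) fune_abse ge0_integralD//.
- by rewrite posV lte_add_pinfty.
- exact: measurable_funepos.
- exact: measurable_funeneg.
Qed.

(** The expected payoff of a strategy is its cost, once the payoff is bounded
    below by an integrable function: then the gains from trading are too. *)
Lemma integral_payoff (th : strategy nu s0) (Z : path_space X -> \bar R) :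
  mu.-integrable setT Z -> (forall x, 0 <= Z x) ->
  (forall x, - Z x <= payoff th x) ->
  mu.-integrable setT (payoff th) /\ \int[mu]_x payoff th x = cost th.
Proof.
move=> iZ Z0 ZP; have [Bg cg] := staticP th.
have ig := integrable_oplus (staticP th).
have im r : mu.-integrable setT (cst r%:E : path_space X -> \bar R).
  exact: finite_measure_integrable_cst.
pose Y x := Z x + oplus (static th) x + `|cash th|%:E.
have iY : mu.-integrable setT Y.
  exact: (integrableD measurableT (integrableD measurableT iZ ig) (im _)).
have [x|x|iV V0] := integral_trading_gain (dynamicP th) iY.
- by rewrite !adde_ge0// ?oplus_ge0// lee_fin.
- have := ZP x; have := Z0 x; have := oplus_ge0 x Bg; rewrite /payoff /Y.
  case: (Z x) (oplus _ x) => [z| |] [g| |]//=; rewrite ?lee_fin ?leNye// => g0 z0.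
  have := ler_norm (cash th); lra.
have icg : mu.-integrable setT (fun x => (cash th)%:E + oplus (static th) x).
  exact: (integrableD measurableT (im (cash th)) ig).
split; first exact: (integrableD measurableT icg iV).
rewrite integralD// V0 adde0 integralD//; last exact: im.
rewrite integral_cst// /cost; congr (_ + _).
  by rewrite -[RHS]mule1; congr (_ * _); exact: probability_setT.
by rewrite (integral_oplus mu_M.1).
Qed.

Lemma superhedging_ge (f : path_space X -> R) (th : strategy nu s0) : Bnu nu f ->
  (forall x, (f x)%:E <= payoff th x) -> \int[mu]_x (f x)%:E <= cost th.
Proof.
move=> Bf fth; have [_ [_ [g posg <-] fg]] := Bf.
have [|x|x|iP <-] := @integral_payoff th (oplus g).
- exact: integrable_oplus.
- by apply: oplus_ge0; exact: posg.1.
- apply: le_trans (fth x); rewrite leeNl -EFinN (le_trans _ (fg x))// lee_fin.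
  by rewrite -normrN ler_norm.
by apply: le_integral => //; exact: integrable_Bnu.
Qed.

(** A positive payoff with non-positive expectation would vanish almost
    everywhere. *)
Lemma no_model_independent_arbitrage (th : strategy nu s0) :
  ~ model_independent_arbitrage th.
Proof.
move=> [cost0 P0].
have i0 : mu.-integrable setT (cst 0 : path_space X -> \bar R) by exact: integrable0.
have [x|x|iP PE] := integral_payoff (th := th) i0.
- exact: lexx.
- by rewrite oppe0 ltW.
have iP0 : \int[mu]_x `|payoff th x| = 0.
  under eq_integral do rewrite gee0_abs ?(ltW (P0 _))//.
  by apply/eqP; rewrite eq_le PE cost0 -PE integral_ge0// => x _; rewrite ltW.
have [+ _] := ae_eq_integral_abs mu measurableT (measurable_int mu iP).
move=> /(_ iP0) [A [mA A0 sub]].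
have AT : A = setT.
  apply/seteqP; split=> // x _; apply: sub => /= /(_ I) Px.
  by have := P0 x; rewrite Px ltxx.
have : 1 = 0 :> \bar R by rewrite -A0 AT; apply/esym; exact: probability_setT.
by move=> /eqP; rewrite onee_eq0.
Qed.

End weak_duality.

(** * The cone of superhedgeable claims *)

Section superhedged.
Context (R : realType) (d : nat) (T : option nat).
Variable X : time_index T -> closed_nonempty R d.
Variable nu : forall n : time_index T, probability (closed_space (X n)) R.
Variable s0 : 'rV[R]_d.
Implicit Types (h : seq (path_space X -> 'rV[R]_d)) (x : path_space X).
Implicit Types (f : path_space X -> R).

Local Notation pos h := (nth (fun=> 0) h).

Lemma trading_gain_pad h N x : (size h <= N)%N ->
  trading_gain s0 h x = gain s0 (pos h) N x.
Proof.
move=> hN; rewrite -(subnKC hN); elim: (N - size h)%N => [|k IH]; first by rewrite addn0.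
rewrite addnS gainS -IH big1 ?addr0// => j _.
by rewrite nth_default ?leq_addr// mxE mul0r.
Qed.

Lemma in_horizon0 (o : option nat) : in_horizon o 0.
Proof. by case: o. Qed.

Definition dynamic_add h h' :=
  mkseq (fun n x => pos h n x + pos h' n x) (maxn (size h) (size h')).

Definition dynamic_scale (a : R) h := [seq (fun x => a *: k x) | k <- h].

Lemma trading_gain_add h h' x :
  trading_gain s0 (dynamic_add h h') x = trading_gain s0 h x + trading_gain s0 h' x.
Proof.
rewrite (trading_gain_pad x (leq_maxl (size h) (size h'))).
rewrite (trading_gain_pad x (leq_maxr (size h) (size h'))).
rewrite (@trading_gain_pad _ (maxn (size h) (size h'))) ?size_mkseq//.
rewrite -big_split/=; apply: eq_bigr => n _; rewrite nth_mkseq//.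
by rewrite /dotp -big_split; apply: eq_bigr => j _; rewrite !mxE mulrDl.
Qed.

Lemma trading_gain_scale a h x :
  trading_gain s0 (dynamic_scale a h) x = a * trading_gain s0 h x.
Proof.
rewrite /trading_gain size_map mulr_sumr; apply: eq_bigr => n _.
rewrite (nth_map (fun=> 0))// /dotp mulr_sumr.
by apply: eq_bigr => j _; rewrite !mxE mulrA.
Qed.

Lemma dynamic_strategy_add h h' : dynamic_strategy s0 h -> dynamic_strategy s0 h' ->
  dynamic_strategy s0 (dynamic_add h h').
Proof.
move=> [hT mh] [h'T mh']; split.
  by rewrite size_mkseq; case: (leqP (size h) (size h')).
move=> n; rewrite size_mkseq => nN; rewrite nth_mkseq//.
have mpos k : dynamic_strategy s0 k ->
    measurable_fun [set: g_sigma_algebraType (filtration_gen s0 n)]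
      (pos k n : _ -> borel_rV R d).
  move=> [_ mk]; have [nk|kn] := ltnP n (size k); first exact: mk.
  by rewrite nth_default//; exact: measurable_cst.
apply: measurable_vector => j; under eq_fun do rewrite mxE.
by apply: measurable_funD; apply: measurable_entry; exact: mpos.
Qed.

Lemma dynamic_strategy_scale a h : dynamic_strategy s0 h ->
  dynamic_strategy s0 (dynamic_scale a h).
Proof.
move=> [hT mh]; split; first by rewrite size_map.
move=> n; rewrite size_map => nN; rewrite (nth_map (fun=> 0))//.
apply: measurable_vector => j; under eq_fun do rewrite mxE.
by apply: measurable_funM => //; apply: measurable_entry; exact: mh.
Qed.

Lemma dynamic_strategy_nil : dynamic_strategy s0 ([::] : seq (path_space X -> 'rV[R]_d)).
Proof. by split=> //; exact: in_horizon0. Qed.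

Lemma static_position0 : static_position nu (fun n => cst 0).
Proof.
split=> [n|]; first by split; [exact: measurable_cst|].
by rewrite /static_cost esum1// => n _; rewrite integral0.
Qed.

(** Real costs suffice because static costs are finite. *)
Definition superhedged : set ((path_space X -> R) * R) :=
  [set fc | exists th : strategy nu s0,
     cost th = fc.2%:E /\ forall x, ((fc.1 x)%:E <= payoff th x)%E].

Lemma superhedgedI m g h f (posg : static_position nu g) : dynamic_strategy s0 h ->
  (forall x, (f x)%:E <= m%:E + oplus g x + (trading_gain s0 h x)%:E)%E ->
  superhedged (f, m + fine (static_cost nu g)).
Proof.
move=> posh fmgh; exists (Strategy m posg posh); split=> //.
by rewrite /cost/= EFinD fineK// static_cost_fin_num.
Qed.

Lemma superhedged_cst f c : (forall x, f x <= c) -> superhedged (f, c).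
Proof.
move=> fc; have := @superhedgedI c _ _ f static_position0 dynamic_strategy_nil.
rewrite /static_cost esum1 ?addr0 => [|n _]; last by rewrite integral0.
apply=> x; rewrite /oplus esum1// /trading_gain big_ord0 !adde0.
by rewrite lee_fin.
Qed.

Lemma superhedged_static g f : static_position nu g ->
  (forall x, (f x)%:E <= oplus g x)%E -> superhedged (f, fine (static_cost nu g)).
Proof.
move=> posg fg; have := @superhedgedI 0 _ _ f posg dynamic_strategy_nil.
rewrite add0r; apply=> x; rewrite /trading_gain big_ord0 adde0 add0e.
exact: fg.
Qed.

Lemma superhedged_gain h : dynamic_strategy s0 h -> superhedged (trading_gain s0 h, 0).
Proof.
move=> posh; have := @superhedgedI 0 _ _ (trading_gain s0 h) static_position0 posh.
rewrite /static_cost esum1 ?addr0 => [|n _]; last by rewrite integral0.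
by apply=> x; rewrite /oplus esum1// !add0e.
Qed.

Lemma superhedged_pricing_cone :
  ~ (exists th : strategy nu s0, uniform_arbitrage th) -> pricing_cone superhedged.
Proof.
move=> noarb; split.
- exact: superhedged_cst.
- move=> f f' c c' [th [cth fth]] [th' [cth' fth']] /=.
  have [Bg _] := staticP th; have [Bg' _] := staticP th'.
  exists (Strategy (cash th + cash th') (static_positionD (staticP th) (staticP th'))
    (dynamic_strategy_add (dynamicP th) (dynamicP th'))).
  rewrite /cost /payoff/=; split.
    by rewrite static_costD// !EFinD -cth -cth' addeACA.
  move=> x; rewrite oplusD// trading_gain_add !EFinD.
  by rewrite (addeACA (cash th)%:E) (addeACA (_ + oplus _ _)%E);
    exact: (leeD (fth x) (fth' x)).
- move=> a f c a0 [th [cth fth]] /=; have [Bg _] := staticP th.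
  exists (Strategy (a * cash th) (static_positionZ a0 (staticP th))
    (dynamic_strategy_scale a (dynamicP th))).
  rewrite /cost /payoff/=; split.
    by rewrite static_costZ// !EFinM -cth /cost muleDr// fin_num_adde_defr.
  move=> x; rewrite oplusZ// trading_gain_scale.
  rewrite !EFinM -muleDr ?fin_num_adde_defr// -muleDr ?fin_num_adde_defl//.
  by apply: lee_wpmul2l; [rewrite lee_fin|exact: fth].
- move=> c [th [cth th0]]; rewrite leNgt; apply/negP => c0.
  by apply: noarb; exists th; split; [rewrite cth lte_fin|exact: th0].
Qed.

End superhedged.

(** * The measure behind a pricing rule *)

Lemma measure_small dsp (E : measurableType dsp) (R : realType) (mu : probability E R)
    (F : (set E)^nat) (e : R) : (forall k, measurable (F k)) -> nonincreasing_seq F ->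
  \bigcap_k F k = set0 -> 0 < e -> exists k, (mu (F k) <= e%:E)%E.
Proof.
move=> mF niF F0 e0.
have : mu \o F @ \oo --> mu (\bigcap_k F k).
  apply: nonincreasing_cvg_mu => //; last by rewrite F0.
  by rewrite (le_lt_trans (probability_le1 mu (mF 0%N)))// ltry.
rewrite F0 measure0 => /fine_cvgP[_ /cvgrPdist_le/(_ e e0)[k _ ke]].
exists k; have := ke k (leqnn k); rewrite sub0r normrN ger0_norm ?fine_ge0//= => {}ke.
by rewrite -lee_fin fineK ?fin_num_measure in ke.
Qed.

Lemma integral_indicT dsp (E : measurableType dsp) (R : realType)
    (mu : probability E R) (A : set E) : measurable A ->
  (\int[mu]_x (\1_A x)%:E = mu A)%E.
Proof. by move=> mA; rewrite integral_indic// setIT. Qed.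

Lemma measurable_open_space (R : realType) (d : nat) (A : closed_nonempty R d)
    (U : set (closed_space A)) : open U -> measurable U.
Proof. exact: sub_sigma_algebra. Qed.

Lemma entry_le_euclidean_norm (R : realType) (d : nat) (u : 'rV[R]_d) (j : 'I_d) :
  `|u ord0 j| <= euclidean_norm u.
Proof.
rewrite -sqrtr_sqr ler_wsqrtr// /dotp (bigD1 j)//= -expr2 lerDl sumr_ge0// => i _.
by rewrite -expr2 sqr_ge0.
Qed.

Section dominated.
Context (R : realType) (d : nat) (T : option nat).
Variable X : time_index T -> closed_nonempty R d.
Variable nu : forall n : time_index T, probability (closed_space (X n)) R.
Variable s0 : 'rV[R]_d.
Implicit Types (f : path_space X -> R).

(** These claims can be superhedged from both sides without dynamic trading, so
    that every pricing rule is defined on them. *)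
Definition dominated : set (path_space X -> R) :=
  [set f | exists c g, static_position nu g /\ forall x, (`|f x|%:E <= c%:E + oplus g x)%E].

Lemma dominated_superhedged f : dominated f ->
  (exists c, superhedged nu s0 (f, c)) /\ (exists c, superhedged nu s0 (- f, c)).
Proof.
move=> [c [g [posg fg]]]; split; exists (c + fine (static_cost nu g));
  apply: (superhedgedI posg (dynamic_strategy_nil _ _)) => x;
  rewrite /trading_gain big_ord0 adde0; apply: le_trans (fg x); rewrite lee_fin.
- exact: ler_norm.
- by rewrite -normrN ler_norm.
Qed.

Lemma dominatedD f f' : dominated f -> dominated f' -> dominated (f + f').
Proof.
move=> [c [g [posg fg]]] [c' [g' [posg' fg']]].
exists (c + c'), (fun n y => g n y + g' n y); split; first exact: static_positionD.
move=> x; rewrite oplusD; [|exact: posg.1|exact: posg'.1].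
rewrite EFinD addeACA; apply: le_trans (leeD (fg x) (fg' x)).
by rewrite -EFinD lee_fin ler_normD.
Qed.

Lemma dominatedZ a f : dominated f -> dominated (a *: f).
Proof.
move=> [c [g [posg fg]]]; exists (`|a| * c), (fun n y => `|a| * g n y).
split; first exact: static_positionZ.
move=> x; rewrite oplusZ//; last exact: posg.1.
rewrite EFinM -muleDr ?fin_num_adde_defr// normrM EFinM.
by apply: lee_wpmul2l; rewrite ?lee_fin// fg.
Qed.

Lemma dominated_bounded f c : (forall x, `|f x| <= c) -> dominated f.
Proof.
move=> fc; exists c, (fun n => cst 0); split; first exact: static_position0.
by move=> x; rewrite /oplus esum1// adde0 lee_fin.
Qed.

Lemma dominated_le f f' : dominated f' -> (forall x, `|f x| <= `|f' x|) -> dominated f.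
Proof.
move=> [c [g [posg fg]]] ff'; exists c, g; split=> // x.
by apply: le_trans (fg x); rewrite lee_fin.
Qed.

Lemma dominated_sum (I : Type) (s : seq I) (F : I -> path_space X -> R) :
  (forall i, dominated (F i)) -> dominated (\sum_(i <- s) F i).
Proof.
move=> dF; elim/big_ind : _ => //; last exact: dominatedD.
by apply: (@dominated_bounded _ 0) => x; rewrite normr0.
Qed.

Lemma dominated_indic A : dominated (\1_A : path_space X -> R).
Proof.
apply: (@dominated_bounded _ 1) => x; rewrite indicE.
by case: (x \in A); rewrite ?normr1// normr0.
Qed.

Lemma dominated_Bnu f : Bnu nu f -> dominated f.
Proof.
move=> [_ [_ [g posg <-] fg]]; exists 0, g; split=> // x.
by rewrite add0e.
Qed.

Lemma dominated_Unu f : Unu nu f -> dominated f.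
Proof.
move=> [_ _ [_ [c fc]] Bneg].
have dneg := dominatedZ (-1) (dominated_Bnu Bneg).
by rewrite -(funrposBneg f) -scaleN1r; exact: dominatedD (dominated_bounded fc) dneg.
Qed.

End dominated.

Section single_position.
Context (R : realType) (d : nat) (T : option nat).
Variable X : time_index T -> closed_nonempty R d.
Variable nu : forall n : time_index T, probability (closed_space (X n)) R.

Lemma esum_single (C : choiceType) (a : C -> \bar R) (c : C) : (0 <= a c)%E ->
  (forall c', c' != c -> a c' = 0)%E -> (\esum_(c' in [set: C]) a c' = a c)%E.
Proof.
move=> ac0 a0; rewrite -(esum_set1 ac0) [RHS]esum_mkcond; apply: eq_esum => c' _.
by case: ifPn => // /negP; rewrite inE => /eqP; exact: a0.
Qed.

Definition single_position n (g : closed_space (X n) -> R) :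
  forall k, closed_space (X k) -> R := dfwith (fun k => cst 0) n g.
Arguments single_position [n] g k _.

Lemma single_position_Bpos n (g : closed_space (X n) -> R) k :
  Bpos g -> Bpos (single_position g k).
Proof.
by move=> Bg; rewrite /single_position; case: dfwithP.
Qed.

Lemma static_cost_single n (g : closed_space (X n) -> R) : Bpos g ->
  static_cost nu (single_position g) = (\int[nu n]_y (g y)%:E)%E.
Proof.
move=> Bg; rewrite /static_cost (@esum_single _ _ n).
- by rewrite /single_position dfwithin.
- by apply: integral_Bpos_ge0 => k; exact: single_position_Bpos.
- by move=> k kn; rewrite /single_position dfwithout ?integral0// eq_sym.
Qed.

Lemma oplus_single n (g : closed_space (X n) -> R) (x : path_space X) : Bpos g ->
  oplus (single_position g) x = (g (coord_proj n x))%:E.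
Proof.
move=> Bg; rewrite /oplus (@esum_single _ _ n).
- by rewrite /single_position dfwithin.
- by rewrite lee_fin; apply: (single_position_Bpos n Bg).2.
- by move=> k kn; rewrite /single_position dfwithout// eq_sym.
Qed.

Lemma single_static_position n (g : closed_space (X n) -> R) : Bpos g ->
  (\int[nu n]_y (g y)%:E < +oo)%E -> static_position nu (single_position g).
Proof.
by move=> Bg ig; split=> [k|]; [exact: single_position_Bpos|rewrite static_cost_single].
Qed.

Lemma dominated_coord n (g : closed_space (X n) -> R) : measurable_fun setT g ->
  (\int[nu n]_y `|g y|%:E < +oo)%E ->
  dominated nu (fun x => g (coord_proj n x)).
Proof.
move=> mg ig; have Bg : Bpos (fun y => `|g y|).
  by split; [exact: measurableT_comp|].
exists 0, (single_position (fun y => `|g y|)); split.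
  exact: single_static_position.
by move=> x; rewrite add0e oplus_single.
Qed.

End single_position.

Section pricing_rule.
Context (R : realType) (d : nat) (T : option nat).
Variable X : time_index T -> closed_nonempty R d.
Variable nu : forall n : time_index T, probability (closed_space (X n)) R.
Variable s0 : 'rV[R]_d.
Variable L : (path_space X -> R) -> R.
Hypothesis LD : forall f f', dominated nu f -> dominated nu f' -> L (f + f') = L f + L f'.
Hypothesis LZ : forall a f, dominated nu f -> L (a *: f) = a * L f.
Hypothesis L_le : forall f c, dominated nu f -> superhedged nu s0 (f, c) -> L f <= c.
Implicit Types (f : path_space X -> R) (A : set (path_space X)).

Lemma ruleN f : dominated nu f -> L (- f) = - L f.
Proof. by move=> df; rewrite -scaleN1r LZ// mulN1r. Qed.

Lemma rule_le f f' : dominated nu f -> dominated nu f' ->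
  (forall x, f x <= f' x) -> L f <= L f'.
Proof.
move=> df df' ff'; have dN := dominatedZ (-1) df'; rewrite scaleN1r in dN.
rewrite -subr_le0 -ruleN// -LD//; apply: L_le; first exact: dominatedD.
by apply: superhedged_cst => x; rewrite subr_le0.
Qed.

Lemma rule_cst c : L (cst c) = c.
Proof.
have dc r : dominated nu (cst r) by apply: (@dominated_bounded _ _ _ _ _ _ `|r|).
apply/eqP; rewrite eq_le L_le//=; last exact: superhedged_cst.
rewrite -lerN2 -ruleN//; apply: L_le; last exact: superhedged_cst.
exact: (dc (- c)).
Qed.

Lemma rule_sum (I : Type) (s : seq I) (F : I -> path_space X -> R) :
  (forall i, dominated nu (F i)) -> L (\sum_(i <- s) F i) = \sum_(i <- s) L (F i).
Proof.
move=> dF; elim: s => [|i s IH]; first by rewrite !big_nil; exact: (rule_cst 0).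
by rewrite !big_cons LD ?IH//; exact: dominated_sum.
Qed.

Lemma rule_static g f : static_position nu g -> dominated nu f ->
  (forall x, (f x)%:E <= oplus g x)%E -> L f <= fine (static_cost nu g).
Proof. by move=> posg df fg; apply: L_le => //; exact: superhedged_static. Qed.

Lemma rule_coord n (g : closed_space (X n) -> R) : Bpos g ->
  (\int[nu n]_y (g y)%:E < +oo)%E ->
  L (fun x => g (coord_proj n x)) <= fine (\int[nu n]_y (g y)%:E)%E.
Proof.
move=> Bg ig; rewrite -static_cost_single//; apply: rule_static.
- exact: single_static_position.
- apply: dominated_coord; first exact: Bg.1.
  by under eq_integral do rewrite ger0_norm ?Bg.2//.
- by move=> x; rewrite oplus_single.
Qed.

Let rule_indic A := L (\1_A).

Let rule_indic_ge0 A : 0 <= rule_indic A.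
Proof.
rewrite -(rule_cst 0); apply: rule_le; [|exact: dominated_indic|].
  by apply: (@dominated_bounded _ _ _ _ _ _ 0) => x; rewrite normr0.
by move=> x; rewrite indicE.
Qed.

Let rule_indicU A B : A `&` B = set0 ->
  rule_indic (A `|` B) = rule_indic A + rule_indic B.
Proof.
move=> AB; rewrite -LD; [|exact: dominated_indic|exact: dominated_indic].
congr L; apply/funext => x; rewrite fctE !indicE in_setU.
case: (boolP (x \in A)); case: (boolP (x \in B)); rewrite ?addr0 ?add0r//.
move=> /set_mem Bx /set_mem Ax; have : (A `&` B) x by split.
by rewrite AB.
Qed.

Let rule_indicT : rule_indic setT = 1.
Proof. by rewrite /rule_indic indicT; exact: rule_cst. Qed.

(** Choose compact sets whose complements have [nu n]-probabilities with a sum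
    of at most [e]. The static position that pays 1 for each coordinate outside
    its compact set superhedges the exit from the product of these sets. *)
Let rule_indic_tight e : 0 < e -> exists2 K, compact K & rule_indic (~` K) <= e.
Proof.
move=> e0.
pose small n (K : set (closed_space (X n))) := [/\ compact K, closed K &
  (nu n (~` K) <= (e / (2 ^ (pickle n).+1)%:R)%:E)%E].
have small_ex n : exists K, small n K.
  have [K [cK clK ndK KT]] := sigma_compact_closed_space (X n).
  have [||||m Km] := @measure_small _ _ _ (nu n) (fun m => ~` K m) (e / (2 ^ (pickle n).+1)%:R).
  - by move=> m; apply: measurable_open_space; exact: closed_openC.
  - by move=> m m' mm'; apply/subsetPset/subsetC/subsetPset/ndK.
  - by rewrite -setC_bigcup KT setCT.
  - by rewrite divr_gt0// ltr0n expn_gt0.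
  - by exists (K m); split.
pose K n := projT1 (cid (small_ex n)).
have KP n : small n (K n) := projT2 (cid (small_ex n)).
exists [set x | forall n, K n (coord_proj n x)].
  by apply: compact_product => n; case: (KP n).
pose g n : closed_space (X n) -> R := \1_(~` K n).
have mK n : measurable (~` K n).
  by apply: measurable_open_space; apply: closed_openC; case: (KP n).
have Bg n : Bpos (g n) by split=> [|y]; [exact: measurable_indic|rewrite /g indicE].
have cg : (static_cost nu g <= e%:E)%E.
  rewrite /static_cost esum_countType; last by move=> n; exact: integral_Bpos_ge0.
  apply: le_trans (epsilon_trick0 xpredT (ltW e0)).
  apply: lee_nneseries => [k _ _|k _].
    by case: pickle_inv => //= n; exact: integral_Bpos_ge0.
  case E : (pickle_inv k) => [n|] /=; last by rewrite lee_fin divr_ge0// ltW.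
  have := @pickle_invK (time_index T) k; rewrite E /= => <-.
  rewrite /g integral_indicT; [by have [_ _] := KP n|exact: mK].
have posg : static_position nu g by split=> //; rewrite (le_lt_trans cg)// ltry.
apply: (@le_trans _ _ (fine (static_cost nu g))).
  apply: rule_static => //; first exact: dominated_indic.
  move=> x; rewrite indicE; case: (boolP (x \in _)) => [|_]; last exact: oplus_ge0.
  rewrite inE => /existsNP[n Kn]; apply: le_trans (le_oplus n x Bg).
  by rewrite /g lee_fin indicE mem_set.
by rewrite -lee_fin fineK// static_cost_fin_num.
Qed.

Definition rule_content : tight_content R (path_space X) :=
  TightContent rule_indic_ge0 rule_indicU rule_indicT rule_indic_tight.

Lemma rule_contentE A : rule_content A = L (\1_A).
Proof. by []. Qed.

Lemma rule_content_coord n (B : set (closed_space (X n))) : measurable B ->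
  rule_content (@coord_proj R d T X n @^-1` B) <= fine (nu n B).
Proof.
move=> mB; have Bg : Bpos (\1_B : closed_space (X n) -> R).
  by split=> [|y]; [exact: measurable_indic|rewrite indicE].
have := @rule_coord n _ Bg; rewrite integral_indicT//; apply.
by rewrite (le_lt_trans (probability_le1 _ mB))// ltry.
Qed.

(** Static positions bound the rule from above; applied to [B] and to its
    complement, the two bounds leave no room. *)
Lemma rule_content_coordE n (B : set (closed_space (X n))) : measurable B ->
  rule_content (@coord_proj R d T X n @^-1` B) = fine (nu n B).
Proof.
move=> mB; apply/eqP; rewrite eq_le rule_content_coord//=.
have := rule_content_coord (measurableC mB); rewrite -preimage_setC contentC.
by rewrite probability_setC// fineB ?fin_num_measure//= lerD2l lerN2.
Qed.

(** Open sets of a coordinate are exhausted by closed sets, and the pricing rule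
    agrees with the countably additive marginal there. *)
Lemma regular_coord_open n (U : set (closed_space (X n))) : open U ->
  regular_set rule_content (@coord_proj R d T X n @^-1` U).
Proof.
move=> oU e e0; have [F cF UF] := open_bigcup_closed oU.
pose G k := \big[setU/set0]_(i < k) F i.
have cG k : closed (G k) by apply: closed_bigsetU => i _; exact: cF.
have GU k : G k `<=` U by rewrite UF; exact: bigsetU_bigcup.
have mUG k : measurable (U `\` G k).
  apply: measurableD; first exact: measurable_open_space.
  by rewrite -[G k]setCK; apply: measurableC; apply: measurable_open_space; exact: closed_openC.
have [||//|k Uk] := @measure_small _ _ _ (nu n) (fun k => U `\` G k) e mUG.
- by move=> k l kl; apply/subsetPset; apply: setDS; exact: subset_bigsetU.
- apply/seteqP; split=> // y Uy; have [Uy0 _] := Uy 0%N I.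
  move: Uy0; rewrite UF => -[i _ Fi]; have [_] := Uy i.+1 I; apply.
  by rewrite /G -bigcup_mkord; exists i => //=; exact: ltnSn.
exists (@coord_proj R d T X n @^-1` G k), (@coord_proj R d T X n @^-1` U); split.
- by apply: preimage_closed => // y _; exact: coord_proj_continuous.
- by apply: open_comp => // y _; exact: coord_proj_continuous.
- exact: preimage_subset.
- by [].
- apply: (le_trans (rule_content_coord (mUG k))).
  by rewrite -lee_fin fineK ?fin_num_measure.
Qed.

Lemma regular_cylinder s : regular_set rule_content (cylinder (X := X) s).
Proof.
elim: s => [|c s IH].
  rewrite (_ : cylinder _ = setT); first exact: regular_setT.
  by apply/seteqP; split.
rewrite cylinder_cons; apply: regular_setI => //.
apply: (@regular_coord_open c.1 (@coords R d (X c.1) @^-1` open_box c.2.1 c.2.2)).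
apply: open_comp; last exact: open_open_box.
by move=> y _; exact: coords_continuous.
Qed.

Lemma open_sigma_regular (U : set (path_space X)) : open U ->
  <<s regular_set rule_content >> U.
Proof.
move=> /open_bigcup_cylinder ->.
have [sigma0 _ sigmaU] := smallest_sigma_algebra setT (regular_set rule_content).
apply: (setU_countType_closed sigma0 sigmaU) => s _.
by apply: sub_sigma_algebra; exact: regular_cylinder.
Qed.

Lemma rule_measure : exists mu : probability (path_space X) R,
  forall A, regular_set rule_content A -> mu A = (L (\1_A))%:E.
Proof. exact: (borel_probability_of_content open_sigma_regular). Qed.

Variable mu : probability (path_space X) R.
Hypothesis muE : forall A, regular_set rule_content A -> mu A = (L (\1_A))%:E.

Lemma rule_marginal : Pnu nu mu.
Proof.
move=> n B mB; apply/esym.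
apply: (@measure_unique _ R (closed_space (X n)) (@open (closed_space (X n)))
  (fun=> setT) _ _ _ _ (nu n) (pushforward mu (@coord_proj R d T X n))) => //.
- by move=> U V; exact: openI.
- by move=> _; exact: openT.
- by rewrite bigcup_const.
- exact: measurable_coord_proj.
- move=> mp U oU; rewrite /= /pushforward muE; last exact: regular_coord_open.
  have mU : measurable U by exact: measurable_open_space.
  by rewrite -rule_contentE rule_content_coordE// fineK// fin_num_measure.
- by move=> _; rewrite (le_lt_trans (probability_le1 _ measurableT))// ltry.
Qed.

Lemma integrable_rule f : measurable_fun setT f -> dominated nu f ->
  mu.-integrable setT (EFin \o f).
Proof.
move=> mf [c [g [posg fg]]].
have ig : mu.-integrable setT (fun x => c%:E + oplus g x)%E.
  apply: (integrableD measurableT); first exact: finite_measure_integrable_cst.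
  apply/integrableP; split; first exact: measurable_oplus posg.1.
  under eq_integral do rewrite gee0_abs ?(oplus_ge0 _ posg.1)//.
  by rewrite (integral_oplus rule_marginal posg.1); exact: posg.2.
apply: le_integrable ig => //; first exact/measurable_EFinP.
by move=> x _; apply: le_trans (fg x) _; exact: lee_abs.
Qed.

Lemma open_regular_exhaustion (U : set (path_space X)) : open U ->
  exists G : (set (path_space X))^nat, [/\ forall k, regular_set rule_content (G k),
    forall k, measurable (G k), nondecreasing_seq G & U = \bigcup_k G k].
Proof.
move=> oU.
pose good : set (set (path_space X)) :=
  [set A | regular_set rule_content A /\ measurable A].
have good0 : good set0 by split; [exact: regular_set0|exact: measurable0].
have good_cylinder s : [set s | cylinder s `<=` U] s -> good (cylinder s).
  move=> _; split; first exact: regular_cylinder.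
  by apply: measurable_open_path; exact: open_cylinder.
have [H gH UH] := bigcup_countType good0 good_cylinder.
exists (fun k => \big[setU/set0]_(i < k.+1) H i); split.
- move=> k; apply: big_ind => [||i _]; [exact: regular_set0|exact: regular_setU|].
  by case: (gH i).
- by move=> k; apply: bigsetU_measurable => i _; case: (gH i).
- by move=> k l kl; apply/subsetPset; exact: subset_bigsetU.
- by rewrite bigcup_bigsetU_bigcup {1}(open_bigcup_cylinder oU).
Qed.

(** The complement of [F] is an increasing union of regular sets, on which the
    rule agrees with [mu]. Mass that escapes along this union makes the measure
    of [F] larger, never smaller, so that only one inequality results. *)
Lemma rule_closed_le (F : set (path_space X)) : closed F ->
  L (\1_F) <= fine (mu F).
Proof.
move=> cF; have oF := closed_openC cF.
have mF : measurable F.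
  by rewrite -[F]setCK; apply: measurableC; exact: measurable_open_path.
have [G [rG mG ndG FG]] := open_regular_exhaustion oF.
apply/ler_addgt0Pr => e e0.
have [|||//|k ke] := @measure_small _ _ _ mu (fun k => ~` G k `\` F) e.
- by move=> k; apply: measurableD => //; exact: measurableC.
- move=> k l kl; apply/subsetPset; apply: setSD; apply: subsetC.
  exact/subsetPset/ndG.
- apply/seteqP; split=> // x GF; have [_ Fx] := GF 0%N I.
  have : (\bigcup_k G k) x by rewrite -FG.
  by move=> [k _ Gx]; have [] := GF k I.
have FGk : F `<=` ~` G k.
  by move=> x Fx Gx; have : (~` F) x by rewrite FG; exists k.
apply: (@le_trans _ _ (L (\1_(~` G k)))).
  apply: rule_le; [exact: dominated_indic|exact: dominated_indic|] => x.
  rewrite !indicE ler_nat; case: (boolP (x \in F)) => [/set_mem/FGk Gx|//].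
  by rewrite mem_set.
rewrite -lee_fin -muE; last exact/regular_setC.
rewrite EFinD fineK ?fin_num_measure//.
apply: le_trans (leeD2l _ ke); rewrite -measureU//; last 2 first.
- by apply: measurableD => //; exact: measurableC.
- by rewrite setDIK.
apply: le_measure; rewrite ?inE.
- exact: measurableC.
- by apply: measurableU => //; apply: measurableD => //; exact: measurableC.
- by move=> x Gx; have [Fx|nFx] := pselect (F x); [left|right].
Qed.

(** The rule is linear and monotone, and the staircases over the level sets of
    [f] are uniformly close to [f]. *)
Lemma rule_le_bounded f c : measurable_fun setT f -> (forall x, `|f x| <= c) ->
  (forall t, L (\1_[set x | t <= f x]) <= fine (mu [set x | t <= f x])) ->
  L f <= \int[mu]_x f x.
Proof.
move=> mf fc level; rewrite -subr_le0; apply: (@le0_of_nat_bound _ _ (c *+ 2)) => N N0.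
set h := _ / _; pose t i := i.+1%:R * h - c.
pose S i := h *: (\1_[set y | t i <= f y] : path_space X -> R).
pose s := cst (- c) + \sum_(i < N) S i.
have sP x : f x - h <= s x <= f x.
  by have := staircase N0 fc x; rewrite /s fctE fct_sumE.
have h0 : 0 <= h by have := sP point; lra.
have mlevel r : measurable [set y | r <= f y].
  by rewrite -[X in measurable X]setTI; exact: measurable_fun_le.
have dS i : dominated nu (S i) by apply: dominatedZ; exact: dominated_indic.
have dcst r : dominated nu (cst r) by apply: (@dominated_bounded _ _ _ _ _ _ `|r|).
have ds : dominated nu s by apply: dominatedD => //; exact: dominated_sum.
have df := dominated_bounded nu fc.
have icst r : mu.-integrable setT (EFin \o (cst r : path_space X -> R)).
  exact: finite_measure_integrable_cst.
have iS i : mu.-integrable setT (EFin \o S i).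
  apply: (integrable_bounded mu (c := h)) => [|x].
    by apply: measurable_funM => //; exact: measurable_indic.
  rewrite normrM ger0_norm// indicE; case: (_ \in _); rewrite ?normr1 ?mulr1//.
  by rewrite normr0 mulr0.
have [iSS ISS] := Rintegral_sum (index_enum 'I_N) (fun i : 'I_N => iS i).
have sE : s = (fun x => - c + \sum_(i < N) S i x) by apply/funext => x; rewrite /s fctE fct_sumE.
have is_ : mu.-integrable setT (EFin \o s).
  by rewrite sE; exact: (integrableD measurableT (icst (- c)) iSS).
have Ls : L s <= \int[mu]_x s x.
  rewrite LD//; last exact: dominated_sum.
  rewrite rule_cst rule_sum// sE RintegralD//; last exact: (icst (- c)).
  rewrite Rintegral_cst_probability lerD2l ISS; apply: ler_sum => i _.
  rewrite LZ; last exact: dominated_indic.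
  by rewrite Rintegral_indicZ// ler_wpM2l.
have : L f <= L s + h.
  rewrite -[X in _ + X]rule_cst -LD//; apply: rule_le => // [|x].
    exact: dominatedD.
  by rewrite -[leRHS]/(s x + h) -lerBlDr; have /andP[] := sP x.
have : \int[mu]_x s x <= \int[mu]_x f x.
  apply: le_Rintegral => // [|x _]; first exact: integrable_rule.
  by have /andP[] := sP x.
by lra.
Qed.

(** Truncation from below extends the bound to functions that are merely
    dominated. *)
Lemma rule_le_integral f c : measurable_fun setT f -> dominated nu f ->
  (forall x, f x <= c) ->
  (forall t, L (\1_[set x | t <= f x]) <= fine (mu [set x | t <= f x])) ->
  ((L f)%:E <= \int[mu]_x (f x)%:E)%E.
Proof.
move=> mf df fc level; pose trunc k x : R := Num.max (f x) (- k%:R).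
have mtrunc k : measurable_fun setT (trunc k).
  by apply: measurable_maxr => //; exact: measurable_cst.
have trunc_bounded k x : `|trunc k x| <= `|c| + k%:R.
  rewrite ler_norml /trunc le_max ge_max; apply/andP; split.
    by rewrite opprD gerDr oppr_le0 normr_ge0 orbT.
  apply/andP; split; first by rewrite (le_trans (fc x))// ler_wpDr// ler_norm.
  by rewrite (@le_trans _ _ 0) ?oppr_le0// addr_ge0.
have L_trunc k : ((L f)%:E <= \int[mu]_x (trunc k x)%:E)%E.
  have dt := dominated_bounded nu (trunc_bounded k).
  rewrite -[leRHS]fineK; last first.
    exact: (integrable_fin_num measurableT (integrable_rule (mtrunc k) dt)).
  rewrite lee_fin; apply: (@le_trans _ _ (L (trunc k))).
    by apply: rule_le => // x; rewrite /trunc le_max lexx.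
  apply: (rule_le_bounded (mtrunc k) (trunc_bounded k)) => t.
  have [tk|tk] := leP t (- k%:R).
    rewrite (_ : mkset _ = setT); last first.
      by apply/seteqP; split=> // x _; rewrite /= /trunc le_max tk orbT.
    rewrite -rule_contentE contentT -[leLHS]/(fine 1%E).
    rewrite le_eqVlt; apply/orP; left; apply/eqP; congr fine.
    by apply/esym; exact: probability_setT.
  rewrite (_ : mkset _ = [set x | t <= f x]) ?level//.
  apply/seteqP; split=> x; rewrite /= /trunc le_max; last by move=> ->.
  by case/orP => // /(lt_le_trans tk); rewrite ltxx.
have intf := integrable_rule mf df.
have cvg_trunc : (\int[mu]_x (trunc k x)%:E)%E @[k --> \oo] --> (\int[mu]_x (f x)%:E)%E.
  apply: (@dominated_cvg _ _ _ mu setT measurableT _ _ (fun x => `|(f x)%:E|%E)).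
  - by move=> k; apply/measurable_EFinP; exact: mtrunc.
  - move=> x _; apply: cvg_near_cst.
    exists (Num.bound `|f x|) => // k /= fk; congr EFin; apply/max_idPl.
    have : `|f x| <= k%:R.
      by rewrite (le_trans (ltW (archi_boundP (normr_ge0 _))))// ler_nat.
    by rewrite ler_norml => /andP[].
  - by [].
  - exact: integrable_abse.
  - move=> k x _; rewrite /= lee_fin /trunc; have [fk|//] := leP (f x) (- k%:R).
    by rewrite normrN ger0_norm// -[`|f x|]normrN (le_trans _ (ler_norm _))// lerNr.
by apply: (cvge_to_ge cvg_trunc); apply: nearW.
Qed.

(** The level sets [t <= f x] of an upper semicontinuous function are closed. *)
Lemma rule_usc_le f : Unu nu f -> ((L f)%:E <= \int[mu]_x (f x)%:E)%E.
Proof.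
move=> Uf; have df := dominated_Unu Uf; have [mf uscf [_ [c fc]] _] := Uf.
apply: (@rule_le_integral _ c) => // [x|t].
  by apply: le_trans (fc x); rewrite ger0_norm /funrpos ?le_max ?lexx// orbT.
apply: rule_closed_le.
rewrite (_ : mkset _ = ~` [set x | (- t)%:E < (- f x)%:E]%E).
  have /lower_semicontinuousP oU := uscf.
  exact: (open_closedC (oU (- t))).
by apply/seteqP; split=> x /=; rewrite lte_fin ltrN2 ltNge; [move=> ->|move/negP; rewrite negbK].
Qed.

Lemma regular_coord_closed n (F : set (closed_space (X n))) : closed F ->
  regular_set rule_content (@coord_proj R d T X n @^-1` F).
Proof.
move=> cF; rewrite -[F]setCK preimage_setC; apply: regular_setC.
exact: (@regular_coord_open n (~` F) (closed_openC cF)).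
Qed.

(** The function [- u] is bounded above and its level sets are regular, which
    gives one inequality for [B] and the same one for its complement. The two
    claims add up to [v], whose cost bounds the rule from above, so that both
    inequalities are equalities. *)
Lemma rule_coord_indic n (v : closed_space (X n) -> R) (B : set (path_space X)) :
  continuous v -> (forall y, 0 <= v y) -> (\int[nu n]_y (v y)%:E < +oo)%E ->
  regular_set rule_content B -> measurable B ->
  let u := fun x => v (coord_proj n x) * \1_B x in
  dominated nu u /\ L u = \int[mu]_x u x.
Proof.
move=> cv v0 iv.
have mv : measurable_fun setT v by exact: (@continuous_borel_measurable _ (closed_space (X n))).
have mvp : measurable_fun setT (fun x : path_space X => v (coord_proj n x)).
  by apply: (measurableT_comp mv); exact: measurable_coord_proj.
have Bv : Bpos v by split.
have dv : dominated nu (fun x => v (coord_proj n x)).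
  by apply: dominated_coord => //; under eq_integral do rewrite ger0_norm//.
pose u (A : set (path_space X)) x := v (coord_proj n x) * \1_A x.
have du A : dominated nu (u A).
  apply: (dominated_le dv) => x; rewrite normrM indicE.
  by case: (x \in A); rewrite ?normr1 ?mulr1// normr0 mulr0.
have mu_ A : measurable A -> measurable_fun setT (u A).
  by move=> mA; apply: measurable_funM => //; exact: measurable_indic.
have lower A : regular_set rule_content A -> measurable A ->
    \int[mu]_x u A x <= L (u A).
  move=> rA mA; have iu := integrable_rule (mu_ A mA) (du A).
  have dNu : dominated nu (- u A) by rewrite -scaleN1r; exact: dominatedZ.
  have mNu : measurable_fun setT (- u A) by apply: measurable_funN; exact: mu_.
  have iNu := integrable_rule mNu dNu.
  have : ((L (- u A))%:E <= \int[mu]_x ((- u A) x)%:E)%E.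
    apply: (@rule_le_integral _ 0) => // [x|t].
      by rewrite oppr_le0 mulr_ge0// indicE.
    have regular_level : regular_set rule_content [set x | t <= (- u A) x].
      have [t0|t0] := leP t 0; last first.
        rewrite (_ : mkset _ = set0); first exact: regular_set0.
        apply/seteqP; split=> // x /=; apply/negP; rewrite -ltNge (le_lt_trans _ t0)//.
        by rewrite oppr_le0 mulr_ge0// indicE.
      rewrite (_ : mkset _ = ~` A `|` @coord_proj R d T X n @^-1` [set y | v y <= - t]).
        apply: regular_setU; first exact: regular_setC.
        apply: regular_coord_closed; rewrite -[mkset _]/(v @^-1` [set r | r <= - t]).
        by apply: preimage_closed; [move=> y _; exact: cv|exact: closed_le].
      apply/seteqP; split=> x /=; rewrite -[(- u A) x]/(- (v (coord_proj n x) * \1_A x)) indicE.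
        case: (boolP (x \in A)) => [xA|xA _]; first by rewrite mulr1 lerNr; right.
        by left; move=> /mem_set; exact/negP.
      case=> [xA|]; first by rewrite memNset// mulr0 oppr0.
      rewrite lerNr => vt; case: (x \in A); by rewrite ?mulr1// mulr0 oppr0.
    by rewrite muE.
  rewrite -[X in (_ <= X)%E]fineK; last exact: (integrable_fin_num measurableT iNu).
  rewrite lee_fin ruleN// -[leRHS]/(\int[mu]_x (- u A) x).
  rewrite (_ : \int[mu]_x (- u A) x = - \int[mu]_x u A x) ?lerN2//.
  under eq_Rintegral do rewrite -[(- u A) _]mulN1r.
  by rewrite RintegralZl// mulN1r.
move=> rB mB u_; rewrite -/(u B) in u_ *; split; first exact: du.
apply/eqP; rewrite eq_le (lower B)// andbT.
have rCB := regular_setC rB; have mCB := measurableC mB.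
have uC : u B + u (~` B) = (fun x => v (coord_proj n x)).
  apply/funext => x; rewrite fctE /u -mulrDr !indicE in_setC.
  by case: (x \in B); rewrite ?addr0 ?add0r mulr1.
have LuC : L (u B) + L (u (~` B)) <= \int[mu]_x u B x + \int[mu]_x u (~` B) x.
  rewrite -LD// uC (le_trans (rule_coord Bv iv))// -RintegralD//; last 2 first.
  - exact: integrable_rule (mu_ _ mB) (du B).
  - exact: integrable_rule (mu_ _ mCB) (du (~` B)).
  have mvE : measurable_fun setT (EFin \o v) by exact/measurable_EFinP.
  have v0E y : (0 <= (EFin \o v) y)%E by rewrite lee_fin.
  have /= <- := integral_coord_proj rule_marginal mvE v0E.
  rewrite le_eqVlt; apply/orP; left; apply/eqP; congr fine.
  by apply: eq_integral => x _; rewrite -[v _]/((fun x => v (coord_proj n x)) x) -uC.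
by have := lower _ rCB mCB; lra.
Qed.


Hypothesis nu_moment : forall n, (\int[nu n]_x (euclidean_norm (coords x))%:E < +oo)%E.

Lemma integral_entry_fin n (j : 'I_d) (g : closed_space (X n) -> R) :
  measurable_fun setT g -> (forall y, 0 <= g y <= `|coords y ord0 j|) ->
  (\int[nu n]_y (g y)%:E < +oo)%E.
Proof.
move=> mg gj; apply: le_lt_trans (nu_moment n).
have mnorm : measurable_fun setT (fun y : closed_space (X n) => euclidean_norm (coords y)).
  apply: (measurableT_comp (continuous_measurable_fun (@sqrt_continuous R))).
  by apply: measurable_sum => i; apply: measurable_funM; exact: measurable_coords_entry.
apply: ge0_le_integral => //.
- by move=> y _; rewrite lee_fin; have /andP[] := gj y.
- exact/measurable_EFinP.
- exact/measurable_EFinP.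
- move=> y _; rewrite lee_fin; have /andP[_ /le_trans] := gj y; apply.
  exact: entry_le_euclidean_norm.
Qed.

(** The positive and the negative part of an entry are both non-negative
    integrable claims on one coordinate. *)
Lemma rule_entry n (j : 'I_d) (B : set (path_space X)) :
  regular_set rule_content B -> measurable B ->
  let u := fun x => coords (coord_proj n x) ord0 j * \1_B x in
  dominated nu u /\ L u = \int[mu]_x u x.
Proof.
move=> rB mB; pose w (y : closed_space (X n)) := coords y ord0 j.
have cw : continuous w by exact: coords_entry_continuous.
have part (v : closed_space (X n) -> R) : continuous v ->
    (forall y, 0 <= v y <= `|w y|) ->
    let u := fun x => v (coord_proj n x) * \1_B x in
    [/\ dominated nu u, L u = \int[mu]_x u x & mu.-integrable setT (EFin \o u)].
  move=> cv vw; have mv : measurable_fun setT v.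
    exact: (@continuous_borel_measurable _ (closed_space (X n))).
  have [||du Lu] := @rule_coord_indic n v B cv _ _ rB mB.
  - by move=> y; have /andP[] := vw y.
  - exact: integral_entry_fin mv vw.
  split=> //; apply: integrable_rule => //; apply: measurable_funM.
    by apply: (measurableT_comp mv); exact: measurable_coord_proj.
  exact: measurable_indic.
have cmax (f : closed_space (X n) -> R) : continuous f -> continuous (fun y => Num.max (f y) 0).
  move=> cf y; apply: (@continuous_max R (closed_space (X n)) f (fun=> 0)).
    exact: cf.
  exact: (@cst_continuous (closed_space (X n)) R 0 y).
have cpos := cmax _ cw.
have cneg : continuous (fun y => Num.max (- w y) 0).
  by apply: cmax => y; apply: continuousN; exact: cw.
have [y|dp Lp ip] := part _ cpos.
  by rewrite le_max lexx orbT ge_max ler_norm normr_ge0.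
have [y|dn Ln in_] := part _ cneg.
  by rewrite le_max lexx orbT ge_max -normrN ler_norm normr_ge0.
have wE : (fun x => w (coord_proj n x) * \1_B x) =
    (fun x => Num.max (w (coord_proj n x)) 0 * \1_B x) +
    - (fun x => Num.max (- w (coord_proj n x)) 0 * \1_B x).
  apply/funext => x; rewrite -[RHS]/(Num.max (w (coord_proj n x)) 0 * \1_B x -
    Num.max (- w (coord_proj n x)) 0 * \1_B x) -mulrBl; congr (_ * _).
  by case: (leP (w (coord_proj n x)) 0) => w0; case: leP => w1; lra.
rewrite /= wE; have dN : dominated nu (- (fun x => Num.max (- w (coord_proj n x)) 0 * \1_B x)).
  by rewrite -scaleN1r; exact: dominatedZ.
split; first exact: dominatedD.
by rewrite LD// ruleN// Lp Ln -RintegralB.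
Qed.

Lemma rule_price k (j : 'I_d) (B : set (path_space X)) : in_horizon T k ->
  regular_set rule_content B -> measurable B ->
  let u := fun x => price s0 k x ord0 j * \1_B x in
  dominated nu u /\ L u = \int[mu]_x u x.
Proof.
case: k => [_|k kT] rB mB /=.
  have dB := dominated_indic nu B.
  split; first exact: (dominatedZ (s0 ord0 j) dB).
  have := LZ (s0 ord0 j) dB; rewrite -[_ *: _]/(fun x => _ * _) => ->.
  by rewrite (Rintegral_indicZ mu _ mB) muE.
rewrite /price insubT; exact: rule_entry.
Qed.

Lemma integrable_price k (j : 'I_d) : in_horizon T k ->
  mu.-integrable setT (fun x => (price s0 k x ord0 j)%:E).
Proof.
move=> kT; apply: integrable_rule.
  by apply: (measurable_filtration (n := k)); exact: adapted_price_entry.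
have [d1 _] := @rule_price k j setT kT (regular_setT _) measurableT.
by apply: (dominated_le d1) => x; rewrite indicT mulr1.
Qed.

Lemma regular_price_open k (V : set 'rV[R]_d) : open V ->
  regular_set rule_content (price s0 k @^-1` V).
Proof.
move=> oV.
have regular_cst (v : 'rV[R]_d) :
    regular_set rule_content ((fun _ : path_space X => v) @^-1` V).
  by rewrite preimage_cst; case: ifP => _; [exact: regular_setT|exact: regular_set0].
case: k => [|k]; first exact: regular_cst.
rewrite /price; case: insub => [i|]; last exact: regular_cst.
apply: (@regular_coord_open i (@coords R d (X i) @^-1` V)).
by apply: open_comp => // y _; exact: coords_continuous.
Qed.

(** Holding one unit of asset [j] between times [n] and [n.+1] on the event [A]
    is a costless strategy, and so is the opposite position. *)
Lemma rule_increment n (j : 'I_d) (A : set (path_space X)) : in_horizon T n.+1 ->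
  <<s filtration_gen s0 n >> A ->
  let u := fun x => price s0 n.+1 x ord0 j * \1_A x - price s0 n x ord0 j * \1_A x in
  dominated nu u -> L u = 0.
Proof.
move=> nT FA u du.
pose h := rcons (nseq n (fun _ : path_space X => 0 : 'rV[R]_d))
  (fun x => \1_A x *: delta_mx ord0 j).
have size_h : size h = n.+1 by rewrite size_rcons size_nseq.
have hP : dynamic_strategy s0 h.
  split; rewrite size_h// => k; rewrite ltnS leq_eqVlt => /predU1P[->|kn]; last first.
    rewrite nth_rcons size_nseq kn nth_nseq kn; exact: measurable_cst.
  rewrite nth_rcons size_nseq ltnn eqxx; apply: measurable_vector => i.
  under eq_fun do rewrite mxE.
  apply: measurable_funM; last exact: measurable_cst.
  exact: (@measurable_indic _ (g_sigma_algebraType (filtration_gen s0 n)) R setT A).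
have gainE : trading_gain s0 h = u.
  apply/funext => x; rewrite (@trading_gain_pad _ _ _ _ _ h n.+1) ?size_h// gainS.
  rewrite /gain big1 ?add0r => [|k _]; last first.
    rewrite nth_rcons size_nseq ltn_ord nth_nseq ltn_ord /dotp big1// => i _.
    by rewrite mxE mul0r.
  rewrite nth_rcons size_nseq ltnn eqxx (bigD1 j)//= big1 ?addr0 => [|i ij].
    by rewrite !mxE !eqxx mulr1 mulrBr /u ![_ * \1_A x]mulrC.
  by rewrite !mxE (negbTE ij) andbF mulr0 mul0r.
apply/eqP; rewrite eq_le; apply/andP; split.
  by apply: L_le => //; rewrite -gainE; exact: superhedged_gain.
rewrite -oppr_le0 -ruleN//; apply: L_le.
  by rewrite -scaleN1r; exact: dominatedZ.
have := superhedged_gain nu (dynamic_strategy_scale (-1) hP).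
rewrite (_ : trading_gain _ _ = - u)//; apply/funext => x.
by rewrite trading_gain_scale gainE mulN1r.
Qed.

(** The regular events up to time [n] form a pi-system. It generates the
    sigma-algebra at time [n] because the preimages of open sets under the prices
    are regular, so that it is enough to know the pricing rule on regular
    events. *)
Lemma rule_martingale : Mnu nu s0 mu.
Proof.
split; first exact: rule_marginal.
split=> [n j nT|n j nT]; first by split; [exact: adapted_price_entry|exact: integrable_price].
have nT' : in_horizon T n by exact: in_horizon_leq nT.
split; [exact: adapted_price_entry|exact: integrable_price|].
pose P : set (set (path_space X)) :=
  [set A | regular_set rule_content A /\ <<s filtration_gen s0 n >> A].
have FP A : P A -> measurable A by move=> [_ /filtration_measurable].
have genP : filtration_gen s0 n `<=` <<s P >>.
  move=> _ [k kn [B mB <-]].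
  have mk : measurable_fun [set: g_sigma_algebraType P] (price s0 k : _ -> borel_rV R d).
    apply: (@measurability _ _ _ (borel_rV R d) _ _ (@open 'rV[R]_d)) => //.
    move=> _ [V oV <-]; rewrite setTI; apply: sub_sigma_algebra; split.
      exact: regular_price_open.
    have mV : @measurable _ (borel_rV R d) V by exact: sub_sigma_algebra.
    by have := @adapted_price _ _ _ X s0 _ _ kn measurableT V mV; rewrite setTI.
  exact: mk.
move=> A FA; apply: (@eq_integral_pi_system _ _ _ mu P) => //.
- move=> C D [rC FC] [rD FD]; split; first exact: regular_setI.
  exact: (@measurableI _ (g_sigma_algebraType (filtration_gen s0 n))).
- split; first exact: regular_setT.
  exact: (@measurableT _ (g_sigma_algebraType (filtration_gen s0 n))).
- exact: integrable_price.
- exact: integrable_price.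
- move=> C PC; have mC := FP C PC; have [rC FC] := PC.
  have [d1 L1] := @rule_price n.+1 j C nT rC mC.
  have [d0 L0] := @rule_price n j C nT' rC mC.
  have dN0 : dominated nu (- (fun x => price s0 n x ord0 j * \1_C x)).
    by rewrite -scaleN1r; exact: dominatedZ.
  have := @rule_increment n j C nT FC (dominatedD d1 dN0).
  rewrite -[X in L X = _]/((fun x => price s0 n.+1 x ord0 j * \1_C x) +
    - (fun x => price s0 n x ord0 j * \1_C x)) LD// ruleN// L1 L0.
  move=> /eqP; rewrite subr_eq0 => /eqP SS.
  have fin k : in_horizon T k ->
      (\int[mu]_x (price s0 k x ord0 j * \1_C x)%:E)%E \is a fin_num.
    move=> kT; apply: (integrable_fin_num measurableT).
    by apply: (integrable_indicM mC); exact: integrable_price.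
  rewrite !(@integral_indicM _ _ _ mu _ C mC).
  by rewrite -[LHS]fineK ?fin// -[RHS]fineK ?fin//; congr EFin; exact: esym SS.
- suff : <<s filtration_gen s0 n >> `<=` <<s P >> by apply.
  by apply: smallest_sub => //; exact: smallest_sigma_algebra.
Qed.

(** The part [oplus g] of [f] takes finite values, as a difference of finite
    functions, so that the rule applies to it; there the bound is the cost of
    [g], which is its integral. *)
Lemma rule_le_UplusG f : Bnu nu f -> UplusG nu (EFin \o f) ->
  ((L f)%:E <= \int[mu]_x (f x)%:E)%E.
Proof.
move=> Bf [h [_ [Uh [g posg <-] fE]]].
have df := dominated_Bnu Bf; have dh := dominated_Unu Uh.
have [mf _] := Bf; have [mh _ _ _] := Uh.
have dNh : dominated nu (- h) by rewrite -scaleN1r; exact: dominatedZ.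
have kE x : ((f - h) x)%:E = oplus g x.
  by rewrite -[(f - h) x]/(f x - h x) EFinB -[(f x)%:E]/((EFin \o f) x) fE addeAC subee// add0e.
have dk := dominatedD df dNh.
have ih := integrable_rule mh dh.
have ik := integrable_rule (measurable_funB mf mh) dk.
have Lk : ((L (f - h))%:E <= \int[mu]_x ((f - h) x)%:E)%E.
  under eq_integral do rewrite kE.
  rewrite (integral_oplus rule_marginal posg.1) -/(static_cost nu g).
  rewrite -[leRHS]fineK ?static_cost_fin_num// lee_fin.
  by apply: rule_static => // x; rewrite kE.
have fhk : f = h + (f - h) by rewrite addrC subrK.
rewrite {1}fhk LD// EFinD.
rewrite (eq_integral (fun x => (h x)%:E + ((f - h) x)%:E)%E) => [|x _]; last first.
  by rewrite {1}fhk EFinD.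
by rewrite integralD//; apply: leeD => //; exact: rule_usc_le.
Qed.

End pricing_rule.

(** * Duality *)

Section duality.
Context (R : realType) (d : nat) (T : option nat).
Variable X : time_index T -> closed_nonempty R d.
Variable nu : forall n : time_index T, probability (closed_space (X n)) R.
Variable s0 : 'rV[R]_d.
Implicit Types (f : path_space X -> R).

(** Keeping the money received for the strategy as cash raises the cost to zero
    and makes the payoff strictly positive. *)
Lemma uniform_arbitrage_model_independent (th : strategy nu s0) :
  uniform_arbitrage th ->
  exists th' : strategy nu s0, model_independent_arbitrage th'.
Proof.
move=> [cost0 P0]; have [Bg cg] := staticP th; set c := fine (static_cost nu (static th)).
have costE : cost th = (cash th + c)%:E.
  by rewrite /cost EFinD fineK// static_cost_fin_num//; exact: staticP.
move: cost0; rewrite costE lte_fin => cost0.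
pose e := - (cash th + c); have e0 : 0 < e by rewrite oppr_gt0.
exists (Strategy (cash th + e) (staticP th) (dynamicP th)); split.
  rewrite /cost/= -[static_cost _ _]fineK; last by apply: static_cost_fin_num; exact: staticP.
  by rewrite -EFinD lee_fin -/c /e; lra.
move=> x; apply: (@lt_le_trans _ _ (e%:E + payoff th x)%E).
  by rewrite (@lt_le_trans _ _ e%:E)// leeDl.
by rewrite /payoff/= (addrC _ e) EFinD -!addeA.
Qed.

Lemma superhedging_le f c : superhedged nu s0 (f, c) -> (superhedging nu s0 f <= c%:E)%E.
Proof. by move=> [th [<- fth]]; apply: ereal_inf_lbound; exists th. Qed.

Lemma integral_le_superhedging f mu : Mnu nu s0 mu -> Bnu nu f ->
  (\int[mu]_x (f x)%:E <= superhedging nu s0 f)%E.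
Proof.
move=> mu_M Bf; apply: le_ereal_inf_tmp => _ [th fth <-].
exact: superhedging_ge.
Qed.

Hypothesis nu_moment : forall n, (\int[nu n]_x (euclidean_norm (coords x))%:E < +oo)%E.

(** Take a linear pricing rule that charges at least [p] for [f]: passing from
    the rule to its martingale measure does not lower the price of [f]. *)
Lemma martingale_measure_above f p :
  ~ (exists th : strategy nu s0, uniform_arbitrage th) ->
  (forall c, superhedged nu s0 (f, c) -> p <= c) ->
  exists2 mu, Mnu nu s0 mu &
    Bnu nu f -> UplusG nu (EFin \o f) -> (p%:E <= \int[mu]_x (f x)%:E)%E.
Proof.
move=> noarb fp.
have [L [LD LZ L_le Lp]] := linear_pricing_rule (superhedged_pricing_cone noarb) fp.
have dE g : dominated nu g -> (exists c, superhedged nu s0 (g, c)) /\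
    exists c, superhedged nu s0 (- g, c) by exact: dominated_superhedged.
have LD' g g' : dominated nu g -> dominated nu g' -> L (g + g') = L g + L g'.
  by move=> /dE Eg /dE; exact: LD.
have LZ' a g : dominated nu g -> L (a *: g) = a * L g by move=> /dE; exact: LZ.
have L_le' g c : dominated nu g -> superhedged nu s0 (g, c) -> L g <= c.
  by move=> /dE; exact: L_le.
have [mu muE] := rule_measure LD' LZ' L_le'.
exists mu; first exact: (rule_martingale muE nu_moment).
move=> Bf UGf; apply: le_trans (rule_le_UplusG muE Bf UGf).
by rewrite lee_fin; apply: Lp; apply: dE; exact: dominated_Bnu.
Qed.

End duality.

Theorem corollary4p6 (R : realType) (d : nat) (T : option nat)
  (X : time_index T -> closed_nonempty R d)
  (s0 : 'rV[R]_d)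
  (nu : forall n : time_index T, probability (closed_space (X n)) R)
  (nu_moment : forall n : time_index T,
     (\int[nu n]_x (euclidean_norm (coords x))%:E < +oo)%E) :
  let no_mi_arbitrage :=
    ~ exists th : strategy nu s0, model_independent_arbitrage th in
  let no_uniform_arbitrage :=
    ~ exists th : strategy nu s0, uniform_arbitrage th in
  let martingale_measure_exists := Mnu nu s0 !=set0 in
  [/\ no_mi_arbitrage <-> no_uniform_arbitrage,
      no_uniform_arbitrage <-> martingale_measure_exists &
      [/\ no_mi_arbitrage, no_uniform_arbitrage & martingale_measure_exists] ->
      forall f : path_space X -> R, Bnu nu f -> UplusG nu (EFin \o f) ->
        (exists2 mu, Mnu nu s0 mu &
           superhedging nu s0 f = (\int[mu]_x (f x)%:E)%E) /\
        (forall mu, Mnu nu s0 mu ->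
           (\int[mu]_x (f x)%:E <= superhedging nu s0 f)%E)].
Proof.
move=> no_mi no_unif has_mart.
have mi_unif : no_mi -> no_unif.
  by move=> nmi [th /uniform_arbitrage_model_independent].
have unif_mart : no_unif -> has_mart.
  move=> nu_; have [_ _ _ cone0] := superhedged_pricing_cone nu_.
  have [mu mu_M _] := martingale_measure_above nu_moment nu_ cone0.
  by exists mu.
have mart_mi : has_mart -> no_mi.
  by move=> [mu mu_M] [th]; exact: (no_model_independent_arbitrage mu_M).
split; [by split=> [/mi_unif//|/unif_mart/mart_mi]|
        by split=> [/unif_mart//|/mart_mi/mi_unif]|].
move=> [_ noarb [mu0 mu0_M]] f Bf UGf.
split; last by move=> mu mu_M; exact: integral_le_superhedging.
have fin : superhedging nu s0 f \is a fin_num.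
  have [[c fc] _] := dominated_superhedged s0 (dominated_Bnu Bf).
  rewrite fin_numE; apply/andP; split; apply/eqP => E.
    have := integral_le_superhedging mu0_M Bf; rewrite E leeNy_eq => /eqP E'.
    have := integrable_fin_num measurableT (integrable_Bnu mu0_M Bf).
    by rewrite -[integral _ _ _]/(\int[mu0]_x (f x)%:E)%E E'.
  by have := superhedging_le fc; rewrite E leye_eq.
have [c fc|mu mu_M f_mu] :=
  @martingale_measure_above _ _ _ _ nu s0 nu_moment f (fine (superhedging nu s0 f)) noarb.
  by rewrite -lee_fin fineK//; exact: superhedging_le.
exists mu => //; apply/eqP; rewrite eq_le integral_le_superhedging// andbT.
by rewrite -[leLHS]fineK//; exact: f_mu.
Qed.
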